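(* Let $$A=\begin{bmatrix}0&0&0&1&0&0\\0&0&0&0&b&0\\0&0&0&0&c&e\\0&0&0&0&d&f\\0&0&0&0&0&g\\0&0&0&0&0&h\end{bmatrix},$$ where $b,c,d,e,h\ge0$, $f,g\in\mathbb R$, $f\ge0$ if $ce=0$ and $f\le0$ otherwise, $b^2+c^2+d^2=1$, $e^2+f^2+g^2+h^2=1$, $ce+df=0$, and $c=0$ whenever $e=0$. Assume in addition that $h\ne0$ and $c^2+d^2>0$. Then: (i) $C(A)$ contains two non-degenerate circles different from $\mathcal C_{1/2}$ if and only if $c=f=g=0$ while $d\ne0,1$. (ii) If this is the case, then $$C(A)=\mathcal C_{\sqrt{1-d}/2}\cup\mathcal C_{\sqrt{1+d}/2}\cup E,$$ where $E$ is the ellipse with the foci $0,h$ and major axis of length one.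
   Context: Put $\operatorname{Re}X=(X+X^* )/2$. The Kippenhahn polynomial of $A\in\mathbb C^{n\times n}$ is $P_A(\lambda,\theta)=\det(\operatorname{Re}(e^{i\theta}A)-\lambda I)$. With $\lambda_1(\theta),\dots,\lambda_n(\theta)$ its roots in $\lambda$, the Kippenhahn curve $C(A)$ is the envelope of the family of lines $\{e^{-i\theta}(\lambda_j(\theta)+i\mathbb R):\theta\in(-\pi,\pi],\ j=1,\dots,n\}$. $\mathcal C_{a,r}$ is the circle of radius $r$ centered at $a$, and $\mathcal C_r=\mathcal C_{0,r}$. For $r>0$, $C(A)\supset\mathcal C_r$ if and only if, for all $\theta$, $P_A(\lambda,\theta)$ is divisible by $\lambda^2-r^2$ as a polynomial in $\lambda$; and $C(A)\supset\mathcal C_{a,r}$ if and only if $C(A-aI)\supset\mathcal C_r$. The two circles in (i) are distinct. The Kippenhahn curve of a direct sum is the union of the Kippenhahn curves of the summands. The ellipse $E$ is the Kippenhahn curve of $\begin{bmatrix}0&\sqrt{1-h^2}\\0&h\end{bmatrix}$; in the degenerate case $h=1$ it is understood as the pair of its foci $\{0,1\}$. *)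

(* Defs.v *)
From HB Require Import structures.
From mathcomp Require Import all_boot all_order all_algebra.
From mathcomp Require Import all_classical all_reals all_analysis.
From mathcomp.real_closed Require Import complex.
Set Implicit Arguments.
Unset Strict Implicit.
Unset Printing Implicit Defensive.
Import Order.TTheory GRing.Theory Num.Theory numFieldNormedType.Exports.
Local Open Scope classical_set_scope.
Local Open Scope complex_scope.
Local Open Scope ring_scope.
Local Open Scope sesquilinear_scope.

Section Kippenhahn.
Variable R : realType.
Local Notation C := R[i].

Definition cis (t : R) : C := cos t +i* sin t.

Definition re_mx n (X : 'M[C]_n) : 'M[C]_n := 2^-1 *: (X + X ^t*).

(* The sign convention is det (H - 'X), not that of [char_poly]. *)
Definition kippenhahn_poly n (A : 'M[C]_n) (t : R) : {poly C} :=
  \det (map_mx polyC (re_mx (cis t *: A)) - 'X%:M).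

(* The line e^{-it} (l + i R) is the set of z with Re (e^{it} z) = l. *)
Definition support_line (l : R -> R) (t : R) (z : C) : R :=
  complex.Re (cis t * z) - l t.

(* Classical envelope of the one-parameter family of curves F t z = 0: the
   points satisfying F = 0 and dF/dt = 0 for a common parameter t. *)
Definition envelope (F : R -> C -> R) : set C :=
  [set z | exists t : R, F t z = 0 /\ is_derive t (1 : R) (F ^~ z) (0 : R)].

(* The roots, with multiplicity, labelled so that each is differentiable in t.
   Such a labelling exists by Rellich's theorem.  It need not be 2pi-periodic
   branch by branch, so it is taken on the whole line; the family of lines is
   the same as for t in ]-pi, pi]. *)
Definition eigen_branches n (A : 'M[C]_n) (lam : 'I_n -> R -> R) : Prop :=
  (forall t, kippenhahn_poly A t = \prod_(j < n) (((lam j t)%:C)%:P - 'X)) /\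
  (forall j t, derivable (lam j) t (1 : R)).

(* For each t, the set of pairs (lam j t, (lam j)^`() t), j < n, does not depend
   on the differentiable labelling, so every labelling yields the same curve. *)
Definition kippenhahn_curve n (A : 'M[C]_n) : set C :=
  [set z | exists2 lam : 'I_n -> R -> R, eigen_branches A lam &
             exists j, envelope (support_line (lam j)) z].

Definition circle (a : C) (r : R) : set C := [set z | `|z - a| = r%:C].

(* Ellipse with foci p, q and major axis of length l; when the distance of the
   foci is l it is, by convention, the pair of foci and not a segment. *)
Definition ellipse (p q : C) (l : R) : set C :=
  if `|p - q| == l%:C then [set p; q]
  else [set z | `|z - p| + `|z - q| = l%:C].

Definition mxA (b c d e f g h : R) : 'M[C]_6 :=
  \matrix_(i < 6, j < 6)
    (nth 0 (nth [::]
      [:: [:: 0; 0; 0; 1; 0; 0];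
          [:: 0; 0; 0; 0; b; 0];
          [:: 0; 0; 0; 0; c; e];
          [:: 0; 0; 0; 0; d; f];
          [:: 0; 0; 0; 0; 0; g];
          [:: 0; 0; 0; 0; 0; h]] i) j)%:C.

End Kippenhahn.

(* Main.v *)
Require Import Defs.
From HB Require Import structures.
From mathcomp Require Import all_boot all_order all_algebra.
From mathcomp Require Import all_classical all_reals all_analysis.
From mathcomp.real_closed Require Import complex.
From mathcomp Require Import ring lra.
Import Order.TTheory GRing.Theory Num.Theory numFieldNormedType.Exports.
Local Open Scope classical_set_scope.
Local Open Scope complex_scope.
Local Open Scope ring_scope.

(** Write [m = 2 lambda], [x = cos theta] and [s = m^2 - 1].  The last three
    columns of the matrix are orthonormal and the others vanish, so a Schur
    complement turns the 6 x 6 determinant into a 3 x 3 one, and (lemma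
    [kippenhahn_poly_mxA]) 64 times the Kippenhahn polynomial is
      [(s^2 - d^2)(s + h^2) - s (f^2 + g^2) - d^2 g^2
         - 2 m x (h (s^2 - d^2) + d f g)],
    a function of [m] and [x] only, of degree one in [x]; it is called [pencil].

    When [c = f = g = 0] it factors as
    [(m^2 - (1 - d)) (m^2 - (1 + d)) (m^2 - 1 + h^2 - 2 h m x)]: two pairs of
    constant branches, which give the two circles, and the support function of
    the ellipse.  At each parameter, one of the three factors vanishes to first
    order along a given differentiable branch ([is_derive_mul_dnbhs0]), so no
    labelling of the branches gives other points; conversely explicit branches
    reach every point of the three curves.

    Suppose now that a circle of centre [a] and radius [r > 0] lies in the
    curve.  Its tangent lines must belong to the family for infinitely many
    directions ([infinite_tangent_root]).  Indeed a point [z] of the curve comes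
    with an angle [t] at which the function
    [t |-> pencil (2 Re (e^{it} z)) (cos t)] has a double zero.  Let [z] run
    through the circle, with parameter [y], and let [F (t, y)] be that function.
    For each [y] the equations [F = F_t = 0] have a solution [t], and an argument
    in the style of the theorem of Sard ([common_zero_sard]) shows that in every interval of [y] some such solution
    also satisfies [F_y = 0].  But [F_y] is the product of [pencil_m] and of
    [2 r sin (t - y)]: either the line is tangent to the circle, or [pencil_m = 0]
    and then, by [F_t = 0], also [sin t pencil_x = 0].  Once a possible factor
    [m^2] is divided out, the second case leaves finitely many lines, and each
    of them meets the circle in at most two points.

    The polynomial identity so obtained,
    [pencil (2 Re (e^{iy} a) + 2 r) (cos y) = 0], has leading
    coefficient [a^5 (a - h)] in [e^{iy}], hence [a = 0] or [a = h]; the case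
    [a = h] would give [r = 0].  So every circle is centred at the
    origin, and both coefficients of the pencil, as a polynomial in [x], vanish
    at [m = 2 r].  If this holds for two radii, then [f = g = 0] and the two
    values of [s] are [d] and [- d] ([two_radii_split]); the rest is immediate. *)

Set Implicit Arguments.
Unset Strict Implicit.
Unset Printing Implicit Defensive.

(** * First order contact with a zero set *)

Lemma is_derive_dnbhs_neq0 (R : realType) (f : R -> R) (t f' : R) :
  is_derive t (1 : R) f f' -> ~ (f t = 0 /\ f' = 0) ->
  \forall u \near t^', f u != 0.
Proof.
move=> df nf.
have cf : {for t, continuous f}.
  by apply/differentiable_continuous/derivable1_diffP; case: df.
have [ft0|ft0] := eqVneq (f t) 0; last first.
  by apply: nbhs_dnbhs; exact: (cvgr_neq0 (f t) cf ft0).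
have /is_derive1_caratheodory[F [hF cF Ft]] := df.
have Ft0 : F t != 0 by apply/eqP => Ft0; apply: nf; rewrite -Ft.
have nF : \forall u \near t^', F u != 0.
  by apply: nbhs_dnbhs; exact: (cvgr_neq0 (F t) cF Ft0).
near=> u.
have : F u * (u - t) != 0.
  by rewrite mulf_neq0 ?subr_eq0 //; near: u => //; exact: nbhs_dnbhs_neq.
by rewrite -hF ft0 subr0.
Unshelve. all: by end_near. Qed.

Lemma is_derive_dnbhs0 (R : realType) (f : R -> R) (t f' : R) :
  (\forall u \near t^', f u = 0) -> is_derive t (1 : R) f f' ->
  f t = 0 /\ f' = 0.
Proof.
move=> f0 df; apply: contrapT => nf.
have nf0 := is_derive_dnbhs_neq0 df nf.
near t^' => u.
have /negP[] : f u != 0 by near: u.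
by apply/eqP; near: u.
Unshelve. all: by end_near. Qed.

(** On the zero set of a product, each point is a limit of zeros of one of the
    factors, and that factor vanishes to first order there. *)
Lemma is_derive_mul_dnbhs0 (R : realType) (f g : R -> R) (t f' : R) :
  (\forall u \near t^', f u * g u = 0) -> is_derive t (1 : R) f f' ->
  (f t = 0 /\ f' = 0) \/ \forall u \near t^', g u = 0.
Proof.
move=> fg df.
have [|nf] := pselect (f t = 0 /\ f' = 0); [by left|right].
have nf0 := is_derive_dnbhs_neq0 df nf.
near=> u.
have /eqP : f u * g u = 0 by near: u.
rewrite mulf_eq0 => /orP[fu|/eqP //].
by have /negP[] : f u != 0 by near: u.
Unshelve. all: by end_near. Qed.

(** * First order Taylor expansions with a uniform quadratic remainder *)

Section Taylor.
Variable R : realType.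
Implicit Types (f g : R * R -> R) (u v : R * R).

(** The sum metric of the plane. *)
Definition l1dist u v : R := `|v.1 - u.1| + `|v.2 - u.2|.

Definition bounded_lipschitz f : Prop :=
  exists2 C : R, 0 <= C &
    forall u v, `|f u| <= C /\ `|f v - f u| <= C * l1dist u v.

(** [f1] and [f2] are the partial derivatives of [f], in the strong form used
    here: all three functions are bounded and Lipschitz on the whole plane, and
    the remainder of the first order expansion is at most a constant times the
    square of the distance, uniformly.  This class is stable under sums and
    products and contains the trigonometric functions of each coordinate. *)
Definition taylor1 f f1 f2 : Prop :=
  [/\ bounded_lipschitz f, bounded_lipschitz f1, bounded_lipschitz f2 &
    exists2 C : R, 0 <= C & forall u v,
      `|f v - f u - (f1 u * (v.1 - u.1) + f2 u * (v.2 - u.2))|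
        <= C * l1dist u v ^+ 2].

Lemma l1dist_ge0 u v : 0 <= l1dist u v.
Proof. exact: addr_ge0. Qed.

Lemma bounded_lipschitz_cst (c : R) : bounded_lipschitz (fun=> c).
Proof.
exists `|c| => // u v; split => //.
by rewrite subrr normr0 mulr_ge0 // l1dist_ge0.
Qed.

Lemma bounded_lipschitzD f g : bounded_lipschitz f -> bounded_lipschitz g ->
  bounded_lipschitz (fun u => f u + g u).
Proof.
move=> [C C0 hf] [D D0 hg]; exists (C + D); first exact: addr_ge0.
move=> u v; have [f1 f2] := hf u v; have [g1 g2] := hg u v; split.
  by rewrite (le_trans (ler_normD _ _)) // lerD.
rewrite opprD addrACA mulrDl.
by rewrite (le_trans (ler_normD _ _)) // lerD.
Qed.

Lemma bounded_lipschitzM f g : bounded_lipschitz f -> bounded_lipschitz g ->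
  bounded_lipschitz (fun u => f u * g u).
Proof.
move=> [C C0 hf] [D D0 hg]; exists (2 * C * D).
  by rewrite !mulr_ge0.
move=> u v; have [f1 f2] := hf u v; have [g1 g2] := hg u v.
have [f3 _] := hf v u; split.
  rewrite normrM (le_trans (ler_pM _ _ f1 g1)) //.
  by rewrite -mulrA ler_peMl ?mulr_ge0 // ler1n.
have -> : f v * g v - f u * g u = f v * (g v - g u) + (f v - f u) * g u.
  by ring.
rewrite (le_trans (ler_normD _ _)) // !normrM.
have -> : 2 * C * D * l1dist u v = C * (D * l1dist u v) + C * l1dist u v * D.
  by ring.
by rewrite lerD // ler_pM // ?mulr_ge0 // ?l1dist_ge0.
Qed.

Lemma taylor1_cst (c : R) : taylor1 (fun=> c) (fun=> 0) (fun=> 0).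
Proof.
split; try exact: bounded_lipschitz_cst.
by exists 0 => // u v; rewrite !mul0r addr0 !subrr normr0.
Qed.

Lemma taylor1D f f1 f2 g g1 g2 : taylor1 f f1 f2 -> taylor1 g g1 g2 ->
  taylor1 (fun u => f u + g u) (fun u => f1 u + g1 u) (fun u => f2 u + g2 u).
Proof.
move=> [hf hf1 hf2 [C C0 hC]] [hg hg1 hg2 [D D0 hD]].
split; try exact: bounded_lipschitzD.
exists (C + D) => [|u v]; first exact: addr_ge0.
rewrite [leRHS]mulrDl.
rewrite (le_trans _ (lerD (hC u v) (hD u v))) //.
rewrite (le_trans _ (ler_normD _ _)) // le_eqVlt; apply/orP; left.
by apply/eqP; congr `|_|; ring.
Qed.

Lemma taylor1M f f1 f2 g g1 g2 : taylor1 f f1 f2 -> taylor1 g g1 g2 ->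
  taylor1 (fun u => f u * g u) (fun u => f1 u * g u + f u * g1 u)
    (fun u => f2 u * g u + f u * g2 u).
Proof.
move=> [hf hf1 hf2 [C C0 hC]] [hg hg1 hg2 [D D0 hD]].
split; first exact: bounded_lipschitzM;
  try by apply: bounded_lipschitzD; exact: bounded_lipschitzM.
case: hf hg => [F F0 hF] [G G0 hG].
exists (F * G + (C * G + F * D)) => [|u v].
  by rewrite !addr_ge0 // mulr_ge0.
have [fu fuv] := hF u v; have [gu guv] := hG u v.
have -> : f v * g v - f u * g u -
    ((f1 u * g u + f u * g1 u) * (v.1 - u.1) +
     (f2 u * g u + f u * g2 u) * (v.2 - u.2)) =
    (f v - f u) * (g v - g u) +
    ((f v - f u - (f1 u * (v.1 - u.1) + f2 u * (v.2 - u.2))) * g u +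
     f u * (g v - g u - (g1 u * (v.1 - u.1) + g2 u * (v.2 - u.2)))) by ring.
have -> : (F * G + (C * G + F * D)) * l1dist u v ^+ 2 =
  (F * l1dist u v) * (G * l1dist u v) +
  ((C * l1dist u v ^+ 2) * G + F * (D * l1dist u v ^+ 2)) by ring.
rewrite (le_trans (ler_normD _ _)) // lerD //.
  by rewrite normrM ler_pM.
by rewrite (le_trans (ler_normD _ _)) // lerD // normrM ler_pM.
Qed.

Lemma taylor1_horner (p : {poly R}) f f1 f2 : taylor1 f f1 f2 ->
  taylor1 (fun u => p.[f u]) (fun u => p^`().[f u] * f1 u)
    (fun u => p^`().[f u] * f2 u).
Proof.
move=> tf; elim/poly_ind: p => [|p c IHp].
  have := taylor1_cst 0; congr taylor1; apply/funext => u;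
    by rewrite ?deriv0 horner0 ?mul0r.
have := taylor1D (taylor1M IHp tf) (taylor1_cst c).
congr taylor1; apply/funext => u.
- by rewrite !hornerE.
- by rewrite derivMXaddC !hornerE; ring.
- by rewrite derivMXaddC !hornerE; ring.
Qed.

Lemma mean_value (g g' : R -> R) (x y : R) :
  (forall x, is_derive x (1 : R) g (g' x)) ->
  exists2 z, `|z - x| <= `|y - x| & g y - g x = g' z * (y - x).
Proof.
move=> dg.
have cont : continuous g.
  move=> z; apply/differentiable_continuous/derivable1_diffP.
  by case: (dg z).
have [xy|yx] := leP x y.
  have [|z] := MVT_segment xy (fun z _ => dg z).
    exact: continuous_subspaceT.
  rewrite in_itv /= => /andP[xz zy] ->; exists z => //.
  by rewrite !ger0_norm ?subr_ge0 // lerD2r.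
have [|z] := MVT_segment (ltW yx) (fun z _ => dg z).
  exact: continuous_subspaceT.
rewrite in_itv /= => /andP[yz zx] h; exists z.
  by rewrite !(distrC _ x) !ger0_norm ?subr_ge0 // ?lerB // ltW.
by rewrite -(opprB x y) mulrN -h opprB.
Qed.

Lemma taylor1_proj (g g' g'' : R -> R) :
  (forall x, is_derive x (1 : R) g (g' x)) ->
  (forall x, is_derive x (1 : R) g' (g'' x)) ->
  (forall x, `|g x| <= 1) -> (forall x, `|g' x| <= 1) ->
  (forall x, `|g'' x| <= 1) ->
  taylor1 (g \o fst) (g' \o fst) (fun=> 0) /\
  taylor1 (g \o snd) (fun=> 0) (g' \o snd).
Proof.
move=> dg dg' g1 g'1 g''1.
have lip (k k' : R -> R) x y : (forall x, is_derive x (1 : R) k (k' x)) ->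
    (forall x, `|k' x| <= 1) -> `|k y - k x| <= `|y - x|.
  move=> dk k'1; have [z _ ->] := mean_value x y dk.
  by rewrite normrM -[leRHS]mul1r ler_wpM2r.
have lg x y := lip _ _ x y dg g'1.
have lg' x y := lip _ _ x y dg' g''1.
have tg x y : `|g y - g x - g' x * (y - x)| <= `|y - x| ^+ 2.
  have [z zx ->] := mean_value x y dg.
  by rewrite -mulrBl normrM expr2 ler_wpM2r // (le_trans (lg' _ _)).
have fstP u v : `|v.1 - u.1| <= l1dist u v by rewrite lerDl.
have sndP u v : `|v.2 - u.2| <= l1dist u v by rewrite lerDr.
split; split; try exact: bounded_lipschitz_cst;
  exists 1 => // u v /=; rewrite ?mul1r.
- by split=> //; rewrite (le_trans (lg _ _)).
- by split=> //; rewrite (le_trans (lg' _ _)).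
- rewrite mul0r addr0 (le_trans (tg _ _)) // lerXn2r //.
  by rewrite nnegrE l1dist_ge0.
- by split=> //; rewrite (le_trans (lg _ _)).
- by split=> //; rewrite (le_trans (lg' _ _)).
- rewrite mul0r add0r (le_trans (tg _ _)) // lerXn2r //.
  by rewrite nnegrE l1dist_ge0.
Qed.

Lemma taylor1_cos : taylor1 (cos \o fst) ((fun x => - sin x) \o fst) (fun=> 0) /\
  taylor1 (cos \o snd) (fun=> 0) ((fun x => - sin x) \o snd).
Proof.
apply: (@taylor1_proj cos (fun x => - sin x) (fun x => - cos x)) => x.
- exact: cos_max.
- by rewrite normrN sin_max.
- by rewrite normrN cos_max.
Qed.

Lemma taylor1_sin : taylor1 (sin \o fst) (cos \o fst) (fun=> 0) /\
  taylor1 (sin \o snd) (fun=> 0) (cos \o snd).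
Proof.
apply: (@taylor1_proj sin cos (fun x => - sin x)) => x.
- exact: sin_max.
- exact: cos_max.
- by rewrite normrN sin_max.
Qed.

End Taylor.

(** * Critical values *)

Section CriticalValues.
Variable R : realType.
Implicit Types (f : R * R -> R) (u v : R * R).

Lemma bounded_lipschitz_continuous f : bounded_lipschitz f -> continuous f.
Proof.
move=> [C C0 hf] u; apply/cvgrPdist_lt => e e0.
have C1 : 0 < 2 * (C + 1) by lra.
have d0 : 0 < e / (2 * (C + 1)) by exact: divr_gt0.
have c1 : v.1 @[v --> u] --> u.1 by exact: cvg_fst.
have c2 : v.2 @[v --> u] --> u.2 by exact: cvg_snd.
move/cvgrPdist_lt: c1 => /(_ _ d0) c1; move/cvgrPdist_lt: c2 => /(_ _ d0) c2.
near=> v.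
have [_ +] := hf v u; move/le_lt_trans; apply.
have v1 : `|u.1 - v.1| < e / (2 * (C + 1)) by near: v.
have v2 : `|u.2 - v.2| < e / (2 * (C + 1)) by near: v.
have : C * l1dist v u <= (C + 1) * l1dist v u.
  by rewrite ler_wpM2r ?l1dist_ge0 // lerDl.
move/le_lt_trans; apply.
have -> : e = (C + 1) * (e / (2 * (C + 1)) + e / (2 * (C + 1))).
  by field; lra.
by rewrite ltr_pM2l ?ltrD //; lra.
Unshelve. all: by end_near. Qed.

(** Among [n + 1] points of an interval of length [T], two are at distance at most
    [T / n]. *)
Lemma pigeonhole_real (n : nat) (T : R) (x : nat -> R) : (0 < n)%N -> 0 < T ->
  (forall i, (i <= n)%N -> 0 <= x i < T) ->
  exists i j, [/\ (i < j)%N, (j <= n)%N & `|x j - x i| <= T / n%:R].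
Proof.
move=> n0 T0 hx.
have n0' : 0 < n%:R :> R by rewrite ltr0n.
pose y i := x i * n%:R / T.
have y0 i : (i <= n)%N -> 0 <= y i.
  by move=> /hx/andP[x0 _]; rewrite !mulr_ge0 // invr_ge0 ltW.
have yn i : (i <= n)%N -> (Num.truncn (y i) < n)%N.
  move=> ilen; have /andP[x0 xT] := hx _ ilen.
  rewrite truncn_lt_nat ?y0 // /y ltr_pdivrMr // mulrC ltr_pM2l //.
pose F (i : 'I_n.+1) : 'I_n := Ordinal (yn i (ltn_ord i)).
have /injectivePn[i [j ij Fij]] : ~~ injectiveb F.
  apply/negP => /injectiveP /leq_card; rewrite !card_ord ltnn //.
have {Fij} : Num.truncn (y i) = Num.truncn (y j) by case: Fij.
wlog : i j ij / (i < j)%N.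
  move=> wlg Fij; have [lij|lji|/val_inj eij] := ltngtP i j.
  - exact: (wlg i j).
  - by apply: (wlg j i) => //; rewrite eq_sym.
  - by rewrite eij eqxx in ij.
move=> lij Fij; exists i, j; split => //; first by rewrite -ltnS.
rewrite ler_pdivlMr // -[X in _ * X](gtr0_norm n0') -normrM.
rewrite -(divfK (lt0r_neq0 T0) (_ * _)) normrM (gtr0_norm T0).
rewrite ler_piMl ?ltW //.
rewrite mulrBl mulrBl -/(y j) -/(y i).
have /andP[i1 i2] := truncn_itv (y0 i (ltn_ord i)).
have /andP[j1 j2] := truncn_itv (y0 j (ltn_ord j)).
rewrite Fij in i1 i2; rewrite ltr_norml; move: i1 i2 j1 j2.
by rewrite -natr1; lra.
Qed.

(** If over every [y] of an interval the curve [f = 0] has a point where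
    [f1], the derivative in the first coordinate, vanishes, then it has one where
    both derivatives vanish.  Otherwise [f2] is bounded away from [0] at these
    points, by compactness; two of them with [t] at distance [O (1 / n)] then have
    [y] at distance [O (1 / n^2)], while [n + 1] equidistant values of [y] are
    [1 / n] apart up to a constant. *)
Lemma common_zero_sard f f1 f2 (T0 T1 a b : R) : taylor1 f f1 f2 ->
  T0 < T1 -> a < b ->
  (forall y, a <= y <= b ->
    exists2 t, T0 <= t < T1 & f (t, y) = 0 /\ f1 (t, y) = 0) ->
  exists t y, [/\ a <= y <= b, f (t, y) = 0, f1 (t, y) = 0 & f2 (t, y) = 0].
Proof.
move=> [hf hf1 hf2 [C C0 hC]] T01 ab crit; apply: contrapT => nex.
pose S u := [/\ a <= u.2 <= b, f u = 0 & f1 u = 0].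
have [c c0 hc] : exists2 c : R, 0 < c & forall u, T0 <= u.1 <= T1 -> S u ->
    c <= `|f2 u|.
  pose psi u := f u * f u + (f1 u * f1 u + f2 u * f2 u).
  have cpsi : continuous psi.
    apply: bounded_lipschitz_continuous.
    by do ?apply: bounded_lipschitzD; exact: bounded_lipschitzM.
  pose K : set (R * R) := `[T0, T1] `*` `[a, b].
  have K0 : K !=set0 by exists (T0, a); split; rewrite /= in_itv /= lexx ltW.
  have cK : compact K by apply: compact_setX; exact: segment_compact.
  have [u uK umin] := compact_EVT_min K0 cK (continuous_subspaceT cpsi).
  have sq0 (x : R) : 0 <= x * x by rewrite -expr2 sqr_ge0.
  have psi0 : 0 < psi u.
    rewrite lt_def !addr_ge0 // andbT; apply/negP => /eqP psi0.
    apply: nex; exists u.1, u.2.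
    move: uK; rewrite inE => -[_ /=]; rewrite in_itv /= => u2.
    rewrite -surjective_pairing.
    move/eqP: psi0; rewrite /psi paddr_eq0 ?addr_ge0 // paddr_eq0 //.
    by rewrite !mulf_eq0 !orbb => /and3P[/eqP-> /eqP-> /eqP->].
  exists (Num.sqrt (psi u)); first by rewrite sqrtr_gt0.
  move=> v v1 [v2 fv f1v].
  rewrite -sqrtr_sqr ler_wsqrtr // expr2.
  have -> : f2 v * f2 v = psi v by rewrite /psi fv f1v; ring.
  by apply: umin; rewrite inE; split; rewrite /= in_itv.
pose T := T1 - T0; pose C' := C + 1.
have T_gt0 : 0 < T by rewrite subr_gt0.
have C'0 : 0 < C' by rewrite /C'; lra.
(* On a y-interval this short the quadratic error in y is absorbed by c. *)
pose d := Num.min (b - a) (c / (4 * C')).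
have d0 : 0 < d by rewrite lt_min subr_gt0 ab divr_gt0 // mulr_gt0.
have dba : d <= b - a by rewrite ge_min lexx.
have dc : 4 * C' * d <= c.
  have : d <= c / (4 * C') by rewrite ge_min lexx orbT.
  by rewrite ler_pdivlMr ?mulr_gt0 // mulrC.
pose n := (Num.bound (4 * C' * T ^+ 2 / (c * d))).+1.
have n_gt : 4 * C' * T ^+ 2 < c * d * n%:R.
  rewrite [ltRHS]mulrC -ltr_pdivrMr ?mulr_gt0 //.
  rewrite (lt_le_trans (archi_boundP _)) ?ler_nat //.
  by rewrite divr_ge0 ?mulr_ge0 ?sqr_ge0 // ltW.
have n0 : 0 < n%:R :> R by rewrite ltr0n.
pose y (i : nat) : R := a + d * i%:R / n%:R.
have yab i : (i <= n)%N -> a <= y i <= b.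
  move=> ilen; have i0 : 0 <= i%:R / n%:R :> R by rewrite divr_ge0 // ltW.
  have i1 : i%:R / n%:R <= 1 :> R by rewrite ler_pdivrMr // mul1r ler_nat.
  rewrite /y -mulrA; have := ler_wpM2l (ltW d0) i1; have := mulr_ge0 (ltW d0) i0.
  by lra.
have /choice[t ht] : forall i, exists t, (i <= n)%N ->
    T0 <= t < T1 /\ f (t, y i) = 0 /\ f1 (t, y i) = 0.
  move=> i; have [ilen|_] := leqP i n; last by exists 0.
  by have [t t1 ?] := crit _ (yab _ ilen); exists t.
have tT i : (i <= n)%N -> 0 <= t i - T0 < T.
  by move=> /ht[/andP[t0 t1] _]; rewrite subr_ge0 t0 ltrD2r.
have [i [j [lij ljn ttT]]] :=
  @pigeonhole_real n T (fun i => t i - T0) isT T_gt0 tT.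
have {}ttT : `|t j - t i| <= T / n%:R by move: ttT; rewrite opprB addrA subrK.
have [ti [fi f1i]] := ht _ (ltnW (leq_trans lij ljn)).
have [tj [fj f1j]] := ht _ ljn.
have cf2 : c <= `|f2 (t i, y i)|.
  apply: hc; last by split=> //; rewrite yab // ltnW // (leq_trans lij).
  by case/andP: ti => ? /ltW ?; apply/andP.
have yji : y j - y i = d * (j - i)%:R / n%:R.
  by rewrite /y natrB ?(ltnW lij) //; field; exact: lt0r_neq0.
have D0 : d / n%:R <= y j - y i.
  rewrite yji ler_pM2r ?invr_gt0 // ler_peMr ?(ltW d0) //.
  by rewrite ler1n subn_gt0.
have Dd : y j - y i <= d.
  rewrite yji ler_pdivrMr // ler_pM2l // ler_nat.
  by rewrite (leq_trans (leq_subr _ _)).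
have Dgt0 : 0 < y j - y i by rewrite (lt_le_trans _ D0) // divr_gt0.
have := hC (t i, y i) (t j, y j).
rewrite fi fj f1i subrr mul0r !add0r normrN normrM /l1dist /=.
rewrite (gtr0_norm Dgt0).
move: (y j - y i) D0 Dd Dgt0 => D D0 Dd Dgt0 hD.
have {}cf2 : c * D <= `|f2 (t i, y i)| * D by rewrite ler_pM2r.
have {hD}h1 : c * D <= 2 * C' * (`|t j - t i| ^+ 2 + D ^+ 2).
  rewrite (le_trans cf2) // (le_trans hD) //.
  have -> : 2 * C' * (`|t j - t i| ^+ 2 + D ^+ 2) =
    C' * ((`|t j - t i| + D) ^+ 2 + (`|t j - t i| - D) ^+ 2) by ring.
  by rewrite ler_pM ?sqr_ge0 // ?lerDl ?sqr_ge0.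
have {}ttT : `|t j - t i| ^+ 2 <= (T / n%:R) ^+ 2.
  by rewrite lerXn2r // nnegrE // divr_ge0 // ltW.
have h2 : 4 * C' * D ^+ 2 <= c * D.
  by rewrite expr2 mulrA ler_pM2r // (le_trans _ dc) // ler_pM2l // mulr_gt0.
have h3 : c * D <= 4 * C' * (T / n%:R) ^+ 2.
  have : 2 * C' * `|t j - t i| ^+ 2 <= 2 * C' * (T / n%:R) ^+ 2.
    by rewrite ler_pM2l // mulr_gt0.
  by lra.
have h4 : c * (d / n%:R) <= 4 * C' * (T / n%:R) ^+ 2.
  by rewrite (le_trans _ h3) // ler_pM2l.
have : c * (d / n%:R) * n%:R ^+ 2 <= 4 * C' * (T / n%:R) ^+ 2 * n%:R ^+ 2.
  by rewrite ler_pM2r // exprn_gt0.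
rewrite (_ : c * (d / n%:R) * _ = c * d * n%:R); last first.
  by field; exact: lt0r_neq0.
rewrite (_ : _ * n%:R ^+ 2 = 4 * C' * T ^+ 2); last first.
  by field; exact: lt0r_neq0.
by rewrite leNgt n_gt.
Qed.

End CriticalValues.

(** * The Kippenhahn polynomial *)

Section Determinants.

(** The Schur complement, cleared of denominators so as to hold over any integral
    domain. *)
Lemma det_schur (K : idomainType) (n m : nat) (X : K) (B : 'M[K]_(n, m))
    (B' : 'M[K]_(m, n)) (D : 'M[K]_m) :
  \det (block_mx (- X)%:M B B' D) * X ^+ m =
    (- X) ^+ n * \det (B' *m B + X *: D).
Proof.
have <- : \det (block_mx 1%:M B (0 : 'M[K]_(m, n)) (X%:M : 'M[K]_m)) = X ^+ m.
  by rewrite det_ublock det1 mul1r det_scalar.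
rewrite -det_mulmx mulmx_block !mulmx0 !mulmx1 !addr0 mul_scalar_mx.
rewrite mul_mx_scalar scaleNr addNr mul_mx_scalar.
by rewrite det_lblock det_scalar.
Qed.

Lemma det_matrix33 (K : comNzRingType) (F : nat -> nat -> K) :
  \det (\matrix_(i < 3, j < 3) F i j) =
    F 0%N 0%N * (F 1%N 1%N * F 2%N 2%N - F 1%N 2%N * F 2%N 1%N)
    - F 0%N 1%N * (F 1%N 0%N * F 2%N 2%N - F 1%N 2%N * F 2%N 0%N)
    + F 0%N 2%N * (F 1%N 0%N * F 2%N 1%N - F 1%N 1%N * F 2%N 0%N).
Proof.
rewrite (expand_det_row _ ord0) !big_ord_recl big_ord0 addr0 /cofactor.
rewrite !(expand_det_row _ ord0) !big_ord_recl !big_ord0 !addr0 /cofactor.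
by rewrite !det_mx11 !mxE /= /bump /=; ring.
Qed.

(** The determinant of [w A + w' A^T - X] when [4 w w' = 1]; the intended values of
    [w] and [w'] are the halves of [e^{it}] and of its conjugate. *)
Lemma det_pencil66 (K : idomainType) (X w w' b c d e f g h : K)
    (M : 'M[K]_6) (A : nat -> nat -> K) (m := 2 * X) (s := m ^+ 2 - 1) :
  X != 0 -> 2 * w * (2 * w') = 1 -> b ^+ 2 + c ^+ 2 + d ^+ 2 = 1 ->
  e ^+ 2 + f ^+ 2 + g ^+ 2 + h ^+ 2 = 1 -> c * e + d * f = 0 ->
  (forall i j, A i j = nth 0 (nth [::]
    [:: [:: 0; 0; 0; 1; 0; 0];
        [:: 0; 0; 0; 0; b; 0];
        [:: 0; 0; 0; 0; c; e];
        [:: 0; 0; 0; 0; d; f];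
        [:: 0; 0; 0; 0; 0; g];
        [:: 0; 0; 0; 0; 0; h]] i) j) ->
  (forall i j, M i j = w * A i j + w' * A j i - X *+ (i == j)) ->
  64 * \det M =
    (s ^+ 2 - d ^+ 2) * (s + h ^+ 2) - s * (f ^+ 2 + g ^+ 2)
    - d ^+ 2 * g ^+ 2
    - 2 * m * (w + w') * (h * (s ^+ 2 - d ^+ 2) + d * f * g).
Proof.
move=> X0 w1 hb he hc hA hM.
pose B : 'M[K]_3 := \matrix_(i, j) (nth 0 (nth [::]
  [:: [:: w; 0; 0]; [:: 0; w * b; 0]; [:: 0; w * c; w * e]] i) j).
pose B' : 'M[K]_3 := \matrix_(i, j) (nth 0 (nth [::]
  [:: [:: w'; 0; 0]; [:: 0; w' * b; w' * c]; [:: 0; 0; w' * e]] i) j).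
pose D : 'M[K]_3 := \matrix_(i, j) (nth 0 (nth [::]
  [:: [:: - X; w * d; w * f];
      [:: w' * d; - X; w * g];
      [:: w' * f; w' * g; (w + w') * h - X]] i) j).
have {hM} -> : \det M = \det (block_mx (- X)%:M B B' D).
  congr (\det _); apply: (etrans (esym (@submxK _ 3 3 3 3 M))).
  by congr block_mx; apply/matrixP => -[[|[|[|//]]] ?] [[|[|[|//]]] ?];
    rewrite !mxE hM !hA /=; ring.
pose F (i j : nat) : K := nth 0 (nth [::]
  [:: [:: w' * w - X ^+ 2; X * (w * d); X * (w * f)];
      [:: X * (w' * d); w' * w * (b ^+ 2 + c ^+ 2) - X ^+ 2;
          w' * w * (c * e) + X * (w * g)];
      [:: X * (w' * f); w' * w * (c * e) + X * (w' * g);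
          w' * w * e ^+ 2 + X * ((w + w') * h - X)]] i) j.
have BF : B' *m B + X *: D = \matrix_(i < 3, j < 3) F i j.
  by apply/matrixP => -[[|[|[|//]]] ?] [[|[|[|//]]] ?];
    rewrite !mxE !big_ord_recl big_ord0 !mxE /F /=; ring.
have -> : \det (block_mx (- X)%:M B B' D) = - \det (B' *m B + X *: D).
  have X3 : X ^+ 3 != 0 by rewrite expf_neq0.
  by apply: (mulIf X3); rewrite det_schur exprNn; ring.
have {}hb : b ^+ 2 + c ^+ 2 = 1 - d ^+ 2 by rewrite -hb; ring.
have {}he : e ^+ 2 = 1 - f ^+ 2 - g ^+ 2 - h ^+ 2 by rewrite -he; ring.
have {}hc : c * e = - (d * f).
  by apply/eqP; rewrite -addr_eq0 hc.
rewrite BF det_matrix33 /F /= hb he hc.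
(* Homogeneous in X, w and w', with 4 w w' in the place of 1. *)
transitivity (
  let p := 2 * w * (2 * w') in let S := m ^+ 2 - p in
  (S ^+ 2 - p ^+ 2 * d ^+ 2) * (S + p * h ^+ 2)
  - p ^+ 2 * S * (f ^+ 2 + g ^+ 2) - p ^+ 3 * d ^+ 2 * g ^+ 2
  - 2 * m * (w + w') * (h * (S ^+ 2 - p ^+ 2 * d ^+ 2)
                 + p ^+ 2 * d * f * g)).
  by rewrite /m /=; ring.
by rewrite w1 /= !expr1n !mul1r.
Qed.

Lemma nth_nth_map (V W : nmodType) (k : V -> W) : k 0 = 0 -> forall L i j,
  k (nth 0 (nth [::] L i) j) = nth 0 (nth [::] (map (map k) L) i) j.
Proof.
move=> k0; elim=> [|l L IHL] [|i] j /=; rewrite ?nth_nil ?k0 //.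
by elim: l j => [|x l IHl] [|j] /=; rewrite ?k0.
Qed.

End Determinants.

Section KippenhahnPolynomial.
Variable R : realType.
Local Notation C := R[i].

Lemma conjCE (z : C) : z^* = conjc z. Proof. by []. Qed.

Lemma conj_real (x : R) : (x%:C : C)^* = x%:C.
Proof. by rewrite conjCE conjc_real. Qed.

Lemma kippenhahn_poly_mxA (b c d e f g h t : R) :
  b ^+ 2 + c ^+ 2 + d ^+ 2 = 1 ->
  e ^+ 2 + f ^+ 2 + g ^+ 2 + h ^+ 2 = 1 ->
  c * e + d * f = 0 ->
  let k (x : R) : {poly C} := (x%:C)%:P in
  let m := 2 * 'X in let s := m ^+ 2 - 1 in
  64 * kippenhahn_poly (mxA b c d e f g h) t =
    (s ^+ 2 - k d ^+ 2) * (s + k h ^+ 2) - s * (k f ^+ 2 + k g ^+ 2)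
    - k d ^+ 2 * k g ^+ 2
    - 2 * m * k (cos t) * (k h * (s ^+ 2 - k d ^+ 2) + k d * k f * k g).
Proof.
move=> hbcd hefgh horth k.
pose W : {poly C} := (cis t / 2)%:P.
pose W' : {poly C} := ((cis t)^* / 2)%:P.
have k0 : k 0 = 0 by rewrite /k rmorph0.
have k1 : k 1 = 1 by rewrite /k rmorph1.
have kM x y : k (x * y) = k x * k y by rewrite /k rmorphM polyCM.
have kD x y : k (x + y) = k x + k y by rewrite /k rmorphD polyCD.
have kW x y :
    (2^-1 * (cis t * x%:C + (cis t * y%:C)^*))%:P = W * k x + W' * k y.
  have -> : (cis t * y%:C)^* = (cis t)^* * y%:C.
    by rewrite rmorphM [X in _ * X]conj_real.
  rewrite /W /W' /k -!polyCM -polyCD; congr polyC.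
  by field.
have W1 : 2 * W * (2 * W') = 1.
  rewrite /W /W' -(polyC_natr _ 2) -!polyCM -polyC1; congr polyC.
  have -> : 2 * (cis t / 2) * (2 * ((cis t)^* / 2)) = cis t * (cis t)^* by field.
  rewrite conjCE /cis; apply/eqP; rewrite eq_complex /=.
  apply/andP; split; apply/eqP.
    by have := cos2Dsin2 t; lra.
  by ring.
have WW' : W + W' = k (cos t).
  rewrite /W /W' /k -polyCD -mulrDl; congr polyC.
  apply: (mulIf (_ : 2 != 0 :> C)) => //.
  rewrite divfK // conjCE; apply/eqP; rewrite eq_complex /=; apply/andP.
  by split; apply/eqP; ring.
have kb := congr1 k hbcd; rewrite !kD !expr2 !kM k1 -!expr2 in kb.
have ke := congr1 k hefgh; rewrite !kD !expr2 !kM k1 -!expr2 in ke.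
have kc := congr1 k horth; rewrite !kD !kM k0 in kc.
have X0 : ('X : {poly C}) != 0 by rewrite polyX_eq0.
rewrite -WW'; pose A i j := k (nth 0 (nth [::]
    [:: [:: 0; 0; 0; 1; 0; 0];
        [:: 0; 0; 0; 0; b; 0];
        [:: 0; 0; 0; 0; c; e];
        [:: 0; 0; 0; 0; d; f];
        [:: 0; 0; 0; 0; 0; g];
        [:: 0; 0; 0; 0; 0; h]] i) j).
apply: (det_pencil66 (A := A) X0 W1 kb ke kc).
  by move=> i j; rewrite /A (nth_nth_map k0) /= k0 k1.
by move=> i j; rewrite !mxE kW.
Qed.

End KippenhahnPolynomial.

(** * The curve in terms of the pencil *)

Section Curve.
Variable R : realType.
Local Notation C := R[i].
Local Notation Re := complex.Re.
Local Notation Im := complex.Im.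

Lemma scaleRE (x y : R) : x *: y = x * y. Proof. by []. Qed.

(** [line_coord z t = 2 Re (e^{it} z)] is the value of [m = 2 lambda] for which the
    line of direction [t] passes through [z]. *)
Definition line_coord (z : C) (t : R) : R := 2 * (cos t * Re z - sin t * Im z).

(** The derivative of [line_coord z] with respect to the angle. *)
Definition line_coord' (z : C) (t : R) : R :=
  - 2 * (sin t * Re z + cos t * Im z).

Lemma Re_cis_mul (z : C) (t : R) : 2 * Re (cis t * z) = line_coord z t.
Proof. by case: z. Qed.

Lemma is_derive_line_coord (z : C) (t : R) :
  is_derive t (1 : R) (line_coord z) (line_coord' z t).
Proof.
have -> : line_coord z = (2 * Re z) \*: (@cos R) + (- 2 * Im z) \*: (@sin R).
  by apply/funext => u; rewrite /line_coord !fctE /= !scaleRE; ring.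
apply: is_derive_eq.
by rewrite /line_coord' !scaleRE; ring.
Qed.

Section Pencil.
Variables d f g h : R.

(** The Kippenhahn polynomial times 64, as a function of [m = 2 lambda] and of
    [x = cos t], is [pencilN - x pencilD]. *)
Definition pencilN : {poly R} := let s := 'X ^+ 2 - 1 in
  (s ^+ 2 - (d ^+ 2)%:P) * (s + (h ^+ 2)%:P) - s * (f ^+ 2 + g ^+ 2)%:P
  - (d ^+ 2 * g ^+ 2)%:P.

Definition pencilD : {poly R} := let s := 'X ^+ 2 - 1 in
  2 * 'X * (h%:P * (s ^+ 2 - (d ^+ 2)%:P) + (d * f * g)%:P).

(** The same function in expanded form, see [pencilE]. *)
Definition pencil (m x : R) : R := let s := m ^+ 2 - 1 in
  (s ^+ 2 - d ^+ 2) * (s + h ^+ 2) - s * (f ^+ 2 + g ^+ 2)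
  - d ^+ 2 * g ^+ 2 - 2 * m * x * (h * (s ^+ 2 - d ^+ 2) + d * f * g).

Lemma pencilE m x : pencil m x = pencilN.[m] - x * pencilD.[m].
Proof.
by rewrite /pencil /pencilN /pencilD -(polyC_natr _ 2) !hornerE /=; ring.
Qed.

End Pencil.

Section Branches.
Variables b c d e f g h : R.
Hypotheses (hbcd : b ^+ 2 + c ^+ 2 + d ^+ 2 = 1)
  (hefgh : e ^+ 2 + f ^+ 2 + g ^+ 2 + h ^+ 2 = 1)
  (horth : c * e + d * f = 0).
Let A := mxA b c d e f g h.

Lemma horner_kippenhahn_poly (l t : R) :
  64 * (kippenhahn_poly A t).[l%:C] = (pencil d f g h (2 * l) (cos t))%:C.
Proof.
have := kippenhahn_poly_mxA t hbcd hefgh horth.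
move=> /(congr1 (fun p => p.[l%:C])) /=.
rewrite -(polyC_natr _ 64) hornerCM => ->.
rewrite /pencil !(rmorphB, rmorphD, rmorphM, rmorphXn, rmorph1) /=.
rewrite -!(polyC_natr _ 2) !hornerE /=.
by ring.
Qed.

Lemma branch_root (lam : 'I_6 -> R -> R) j t : eigen_branches A lam ->
  pencil d f g h (2 * lam j t) (cos t) = 0.
Proof.
move=> [/(_ t) hlam _]; apply: (fmorph_inj (real_complex R)).
rewrite -[LHS]horner_kippenhahn_poly hlam horner_prod (bigD1 j) //=.
by rewrite hornerD hornerN hornerX hornerC subrr mul0r mulr0 rmorph0.
Qed.

(** A point of the curve lies on a line of the family, and to first order a
    differentiable branch of the zero set of the pencil follows the pencil of
    lines through that point. *)
Lemma kippenhahn_curve_branch z : kippenhahn_curve A z ->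
  exists (mu : R -> R) (t : R), [/\ forall u, pencil d f g h (mu u) (cos u) = 0,
    mu t = line_coord z t & is_derive t (1 : R) mu (line_coord' z t)].
Proof.
move=> [lam hlam [j [t [lam0 dlam]]]].
exists (2 \*: lam j), t; split=> [u||].
- exact: branch_root.
- rewrite -Re_cis_mul; congr (_ * _); apply/esym/eqP.
  by rewrite -subr_eq0; apply/eqP.
have -> : 2 \*: lam j = line_coord z - 2 \*: (support_line (lam j) ^~ z).
  apply/funext => u; rewrite !fctE /= /support_line -Re_cis_mul !scaleRE.
  by ring.
have := is_derive_line_coord z t => ?.
by apply: is_derive_eq; rewrite scaler0 subr0.
Qed.

Lemma kippenhahn_curve_of_branch (lam : 'I_6 -> R -> R) j z t :
  eigen_branches A lam -> 2 * lam j t = line_coord z t ->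
  is_derive t (1 : R) (fun u => 2 * lam j u) (line_coord' z t) ->
  kippenhahn_curve A z.
Proof.
move=> hlam lam0 dlam; exists lam => //; exists j, t; split.
  rewrite /support_line; have := Re_cis_mul z t; rewrite -lam0.
  by lra.
have -> : support_line (lam j) ^~ z =
    2^-1 \*: (line_coord z - (fun u => 2 * lam j u)).
  apply/funext => u; rewrite !fctE /= /support_line -Re_cis_mul !scaleRE.
  by field.
have := is_derive_line_coord z t => ?.
by apply: is_derive_eq; rewrite subrr scaler0.
Qed.

End Branches.
End Curve.

(** * Finite sets of parameters *)

Section FiniteSets.

Lemma finite_roots (K : idomainType) (p : {poly K}) : p != 0 ->
  finite_set [set x | p.[x] = 0].
Proof.
move: {2}(size p) (leqnn (size p)) => n; elim: n p => [|n IHn] p szp p0.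
  by move: szp; rewrite leqn0 size_poly_eq0 (negbTE p0).
have [[x /eqP/factor_theorem[q pE]]|nroot] := pselect (exists x, p.[x] = 0); last first.
  by apply: (sub_finite_set _ (finite_set0 K)) => x /= px; case: nroot; exists x.
have q0 : q != 0 by apply: contraNneq p0 => q0; rewrite pE q0 mul0r.
have szq : (size q <= n)%N.
  by move: szp; rewrite pE size_Mmonic ?monicXsubC // size_XsubC addnC.
have fin : finite_set ([set y | q.[y] = 0] `|` [set x]).
  by rewrite finite_setU; split; [exact: IHn|exact: finite_set1].
apply: sub_finite_set fin => y /=.
rewrite pE hornerM hornerXsubC => /eqP; rewrite mulf_eq0 subr_eq0.
by case/orP => /eqP; [left|right].
Qed.

(** A polynomial given by the sequence of its coefficients, with infinitely many
    zeros, has only zero coefficients. *)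
Lemma horner_rec_infinite (K : idomainType) (s : seq K) (I : set K) :
  infinite_set I -> (forall x, I x -> horner_rec s x = 0) ->
  forall i, s`_i = 0.
Proof.
move=> infI hs i; rewrite -coef_Poly.
suff -> : Poly s = 0 by rewrite coef0.
apply: contrapT => /eqP/finite_roots; apply: sub_infinite_set infI => x Ix /=.
by rewrite horner_Poly hs.
Qed.

Variable R : realType.

(** A segment contains a nondegenerate segment free of a given finite set. *)
Lemma finite_avoid (F : set R) (a b : R) : finite_set F -> a < b ->
  exists c d, [/\ a <= c, c < d, d <= b & forall x, c <= x <= d -> ~ F x].
Proof.
move=> /finite_seqP[s ->]; elim: s => [|y s IHs] ab; first by exists a, b; split.
have [c [d [ac cd db cds]]] := IHs ab.
have [yc|cy] := ltP y ((c + d) / 2).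
  exists ((c + d) / 2), d; split => //; [lra|lra|] => x /andP[x1 x2].
  rewrite /= inE => /orP[/eqP xy|xs]; first by move: x1 yc; rewrite xy; lra.
  by apply: (cds x) => //; apply/andP; split => //; lra.
exists c, ((3 * c + d) / 4); split => //; [lra|lra|] => x /andP[x1 x2].
rewrite /= inE => /orP[/eqP xy|xs]; first by move: x2 cy; rewrite xy; lra.
by apply: (cds x) => //; apply/andP; split => //; lra.
Qed.

Lemma infinite_setT_real : infinite_set [set: R].
Proof.
move=> finT; have [c [d [_ cd _ /(_ c)]]] := finite_avoid finT (@ltr01 R).
by apply=> //; rewrite lexx ltW.
Qed.

(** The cosine is injective on the unit interval, over which the parameter of
    the circles below ranges. *)
Lemma finite_cos_preimage (F : set R) : finite_set F ->
  finite_set [set y : R | 0 <= y <= 1 /\ F (cos y)].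
Proof.
move=> /(finite_image acos); apply: sub_finite_set => y /= [/andP[y0 y1] Fy].
exists (cos y) => //; rewrite cosK // in_itv /= y0 /=.
by rewrite (le_trans y1) // (le_trans _ (pi_ge2 R)) // ler1n.
Qed.

Lemma ex_angle (x y : R) : x ^+ 2 + y ^+ 2 = 1 ->
  exists t, [/\ -4 <= t < 4, cos t = x & sin t = y].
Proof.
move=> xy1.
have x1 : -1 <= x <= 1 by apply/andP; split; nra.
have p4 : (pi : R) < 4 by have := pihalf_lt2 R; lra.
have a0 := acos_ge0 x1; have ap := acos_lepi x1.
have sa : sin (acos x) = `|y|.
  by rewrite sin_acos // -xy1 addrC addKr sqrtr_sqr.
have ca : cos (acos x) = x by rewrite acosK.
have [y0|y0] := leP 0 y.
  by exists (acos x); split; rewrite ?sa ?ger0_norm //; apply/andP; split; lra.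
exists (- acos x); split; rewrite ?cosN // ?sinN ?sa ?ltr0_norm ?opprK //.
by apply/andP; split; lra.
Qed.

End FiniteSets.

(** * Tangent lines of a circle contained in an envelope *)

Section Tangency.
Variable R : realType.
Local Notation C := R[i].
Local Notation Re := complex.Re.
Local Notation Im := complex.Im.

(** The point [a + r e^{-iy}] of the circle; the line of direction [y] is tangent
    to the circle there. *)
Definition circle_pt (a : C) (r y : R) : C :=
  (Re a + r * cos y) +i* (Im a - r * sin y).

Lemma line_coord_circle_pt a r y t : line_coord (circle_pt a r y) t =
  2 * (Re a * cos t - Im a * sin t + r * cos (t - y)).
Proof. by rewrite /line_coord /= cosB; ring. Qed.

Lemma line_coord'_circle_pt a r y t : line_coord' (circle_pt a r y) t =
  - 2 * (Re a * sin t + Im a * cos t + r * sin (t - y)).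
Proof. by rewrite /line_coord' /= sinB; ring. Qed.

(** A line meets the circle in finitely many points.  The triple [l] stands for the
    line of direction [t] at [m], with [cos t], [sin t] and [m] as its entries. *)
Lemma finite_line_circle (a : C) (r : R) (l : R * R * R) : r != 0 ->
  l.1.1 ^+ 2 + l.1.2 ^+ 2 = 1 ->
  finite_set [set y | 0 <= y <= 1 /\
    2 * (l.1.1 * Re (circle_pt a r y) - l.1.2 * Im (circle_pt a r y)) = l.2].
Proof.
case: l => [[x w] m] /= r0 xw1.
have [k kE] : exists k, k = (m / 2 - x * Re a + w * Im a) / r by eexists.
pose p : {poly R} := 'X ^+ 2 - (2 * k * x)%:P * 'X + (k ^+ 2 - w ^+ 2)%:P.
have p0 : p != 0.
  apply/eqP => /(congr1 (fun q : {poly R} => q`_2)); rewrite /p.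
  rewrite coefD coefB coefXn coefCM coefX coefC /= coef0 => /eqP.
  by rewrite mulr0 subr0 addr0 oner_eq0.
apply: sub_finite_set (finite_cos_preimage (finite_roots p0)).
move=> y /= [y01 hy]; split => //.
have hk : x * cos y + w * sin y = k by rewrite kE -hy; field.
rewrite /p !hornerE /= -hk.
have := cos2Dsin2 y; have -> : sin y ^+ 2 = sin y * sin y by rewrite expr2.
move=> cs; have {}cs : sin y * sin y = 1 - cos y ^+ 2 by rewrite -cs; ring.
have -> : w ^+ 2 = w * w by rewrite expr2.
have ww : w * w = 1 - x ^+ 2 by rewrite -xw1; ring.
transitivity (cos y * cos y * (1 - x ^+ 2) + w * w * (sin y * sin y) - w * w).
  by ring.
by rewrite cs ww; ring.
Qed.

Section Pencil.
Variables (N D : {poly R}) (a : C) (r : R) (X : set R).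
Hypothesis r_neq0 : r != 0.

Let m (y t : R) := line_coord (circle_pt a r y) t.
Let m' (y t : R) := line_coord' (circle_pt a r y) t.
Let P (y t : R) := N.[m y t] - cos t * D.[m y t].
Let P' (y t : R) := (N^`().[m y t] - cos t * D^`().[m y t]) * m' y t
  + sin t * D.[m y t].
Let Q (y t : R) := (N^`().[m y t] - cos t * D^`().[m y t])
  * (2 * r * sin (t - y)).

Let taylor_P : taylor1 (fun u => P u.2 u.1) (fun u => P' u.2 u.1)
  (fun u => Q u.2 u.1).
Proof.
have [ct cy] := taylor1_cos R; have [st sy] := taylor1_sin R.
have cst k := taylor1_cst (k : R).
have tm : taylor1 (fun u => m u.2 u.1) (fun u => m' u.2 u.1)
    (fun u => 2 * r * sin (u.1 - u.2)).
  have := taylor1M (cst 2) (taylor1D (taylor1D (taylor1M (cst (Re a)) ct)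
    (taylor1M (cst (- Im a)) st))
    (taylor1M (cst r) (taylor1D (taylor1M ct cy) (taylor1M st sy)))).
  congr taylor1; apply/funext => u /=.
  - by rewrite /m line_coord_circle_pt cosB; ring.
  - by rewrite /m' line_coord'_circle_pt sinB; ring.
  - by rewrite sinB; ring.
have := taylor1D (taylor1_horner N tm)
  (taylor1M (cst (-1)) (taylor1M ct (taylor1_horner D tm))).
by congr taylor1; apply/funext => u /=; rewrite /P /P' /Q; ring.
Qed.

(** Let [P = N - cos t D], and suppose that, for all [y] of the unit interval outside
    a finite set [X], the function [P] of the lines through the point of parameter
    [y] has a double zero at some angle.  Then, for infinitely many [y], the tangent of
    the circle at that point is a zero of [P].  The third hypothesis says that the
    zeros of [N - x D] have no double component on which [m] is constant. *)
Lemma infinite_tangent :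
  (forall x : R, x ^+ 2 = 1 -> N - x%:P * D != 0) -> D != 0 ->
  (forall k, D.[k] = 0 -> D^`().[k] = 0 -> N.[k] = 0 -> N^`().[k] = 0 ->
    False) ->
  finite_set X ->
  (forall y, 0 <= y <= 1 -> ~ X y -> exists t, P y t = 0 /\ P' y t = 0) ->
  infinite_set [set y | 0 <= y <= 1 /\
    exists t, sin (t - y) = 0 /\ P y t = 0].
Proof.
move=> hND D0 hsing finX hcrit finT.
(* The singular points of N = x D: there N' = x D' and D sin t = 0.  Those with
   sin t = 0 form Tr1, those with D = 0 form Tr2. *)
pose Tr1 : set (R * R * R) :=
  [set l | l.1.1 ^+ 2 + l.1.2 ^+ 2 = 1 /\ (l.1.2 = 0 /\
     (N - l.1.1%:P * D).[l.2] = 0)].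
pose Tr2 : set (R * R * R) :=
  [set l | l.1.1 ^+ 2 + l.1.2 ^+ 2 = 1 /\ [/\ D.[l.2] = 0, D^`().[l.2] != 0 &
     N^`().[l.2] = l.1.1 * D^`().[l.2]]].
have finTr1 : finite_set Tr1.
  pose F (x : R) : set (R * R * R) :=
    (fun k => (x, 0, k)) @` [set k | (N - x%:P * D).[k] = 0].
  have fin1 (x : R) : x ^+ 2 = 1 -> finite_set (F x).
    by move=> x1; apply/finite_image/finite_roots/hND.
  have : finite_set (F 1 `|` F (-1)).
    by rewrite finite_setU; split; apply: fin1; ring.
  apply: sub_finite_set => -[[x w] k] [/= xw [w0 hk]].
  have /eqP : x ^+ 2 = 1 by rewrite -xw w0; ring.
  rewrite sqrf_eq1 => /orP[] /eqP x1; [left|right];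
    by exists k; rewrite ?x1 ?w0 //= -x1.
have finTr2 : finite_set Tr2.
  pose x k := N^`().[k] / D^`().[k].
  have finD := finite_roots D0.
  pose F (e : R) : set (R * R * R) :=
    (fun k => (x k, e * Num.sqrt (1 - x k ^+ 2), k)) @` [set k | D.[k] = 0].
  have : finite_set (F 1 `|` F (-1)).
    by rewrite finite_setU; split; exact: finite_image.
  apply: sub_finite_set => -[[x0 w] k] [/= xw [Dk D'k Nk]].
  have xE : x0 = x k by rewrite /x Nk mulfK.
  have sE : Num.sqrt (1 - x k ^+ 2) = `|w|.
    by rewrite -xE -xw addrC addKr sqrtr_sqr.
  have [w0|w0] := leP 0 w; [left|right]; exists k => //; rewrite sE xE.
    by rewrite ger0_norm // mul1r.
  by rewrite ltr0_norm // mulrNN mul1r.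
pose line (l : R * R * R) : set R := [set y | 0 <= y <= 1 /\
    2 * (l.1.1 * Re (circle_pt a r y) - l.1.2 * Im (circle_pt a r y)) = l.2].
pose S := \bigcup_(l in Tr1 `|` Tr2) line l.
have finS : finite_set S.
  apply: bigcup_finite => [|l]; first by rewrite finite_setU.
  by case=> [[l1 _]|[l1 _]]; exact: finite_line_circle.
(* On a segment avoiding all exceptional parameters the common zero of P and of
   its two derivatives can be neither tangent nor singular. *)
have finF : finite_set ((X `|` S) `|` [set y | 0 <= y <= 1 /\
    exists t, sin (t - y) = 0 /\ P y t = 0]).
  by rewrite !finite_setU.
have [b0 [b1 [b00 b01 b11 hb]]] := finite_avoid finF (@ltr01 R).
have T4 : -4 < 4 :> R by lra.
have crit y : b0 <= y <= b1 -> exists2 t, -4 <= t < 4 & P y t = 0 /\ P' y t = 0.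
  move=> /[dup] yb /andP[y0 y1].
  have [|nXy|t [Pt P't]] := hcrit y; first by apply/andP; split; lra.
    by apply: (hb y yb); left; left.
  have [u [u4 cu su]] := ex_angle (cos2Dsin2 t).
  exists u => //=; move: Pt P't.
  by rewrite /P /P' /m /m' /line_coord /line_coord' cu su.
have [t [y [yb Pty P'ty Qty]]] := common_zero_sard taylor_P T4 b01 crit.
have y01 : 0 <= y <= 1 by case/andP: yb => *; apply/andP; split; lra.
apply: (hb y yb).
move: Qty => /= /eqP; rewrite /Q mulf_eq0 => /orP[/eqP P'0|]; last first.
  rewrite !mulf_eq0 (negbTE r_neq0) pnatr_eq0 /= => /eqP s0.
  by right; split => //; exists t.
left; right; exists (cos t, sin t, m y t); last by split.
move: Pty P'ty => /=; rewrite /P /P' P'0 mul0r add0r => Pty /eqP.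
have cs := cos2Dsin2 t.
rewrite mulf_eq0 => /orP[] /eqP h0; [left|right]; split => //=.
  by split => //; rewrite !hornerE.
have N0 : N.[m y t] = 0 by rewrite -Pty h0; ring.
have N'E : N^`().[m y t] = cos t * D^`().[m y t].
  by apply/eqP; rewrite -subr_eq0 P'0.
split => //; apply/eqP => D'0; apply: (hsing (m y t)) => //.
by rewrite N'E D'0 mulr0.
Qed.

End Pencil.
End Tangency.

(** The polynomial [v^6 pencil (L / v) ((1 + v^2) / (2 v))] in the variable [v],
    with [d2], [h2], [k], [dg], [h] and [dfg] in the place of [d^2], [h^2],
    [f^2 + g^2], [d^2 g^2], [h] and [d f g]. *)
Definition homogenized (K : comNzRingType) (L : {poly K})
    (d2 h2 k dg h dfg : K) : {poly K} :=
  ((L ^+ 2 - 'X ^+ 2) ^+ 2 - d2%:P * 'X ^+ 4)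
    * (L ^+ 2 - 'X ^+ 2 + h2%:P * 'X ^+ 2)
  - 'X ^+ 4 * (L ^+ 2 - 'X ^+ 2) * k%:P - dg%:P * 'X ^+ 6
  - L * (1 + 'X ^+ 2)
    * (h%:P * ((L ^+ 2 - 'X ^+ 2) ^+ 2 - d2%:P * 'X ^+ 4)
       + dfg%:P * 'X ^+ 4).

Lemma horner_homogenized (K : comNzRingType) (L : {poly K})
    (d2 h2 k dg h dfg v : K) :
  (homogenized L d2 h2 k dg h dfg).[v] =
    ((L.[v] ^+ 2 - v ^+ 2) ^+ 2 - d2 * v ^+ 4)
      * (L.[v] ^+ 2 - v ^+ 2 + h2 * v ^+ 2)
    - v ^+ 4 * (L.[v] ^+ 2 - v ^+ 2) * k - dg * v ^+ 6
    - L.[v] * (1 + v ^+ 2)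
      * (h * ((L.[v] ^+ 2 - v ^+ 2) ^+ 2 - d2 * v ^+ 4) + dfg * v ^+ 4).
Proof. by rewrite !hornerE. Qed.

(** * Circles contained in the curve *)

Section CircleInCurve.
Variable R : realType.
Local Notation C := R[i].
Local Notation Re := complex.Re.
Local Notation Im := complex.Im.

Lemma is_derive_pencil (N D : {poly R}) (mu : R -> R) (t m' : R) :
  is_derive t (1 : R) mu m' ->
  is_derive t (1 : R) (fun u => N.[mu u] - cos u * D.[mu u])
    ((N^`().[mu t] - cos t * D^`().[mu t]) * m' + sin t * D.[mu t]).
Proof.
move=> dmu.
have -> : (fun u => N.[mu u] - cos u * D.[mu u]) =
    (horner N \o mu) - @cos R * (horner D \o mu) by [].
apply: is_derive_eq.
by rewrite !scaleRE /=; ring.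
Qed.

Lemma line_coord_eq0 (z : C) (t : R) :
  line_coord z t = 0 -> line_coord' z t = 0 -> z = 0.
Proof.
case: z => x y; rewrite /line_coord /line_coord' /= => h1 h2.
have cs := cos2Dsin2 t.
have {}h1 : cos t * x - sin t * y = 0 by lra.
have {}h2 : sin t * x + cos t * y = 0 by lra.
have hx : x = cos t * (cos t * x - sin t * y) + sin t * (sin t * x + cos t * y).
  by rewrite -[LHS]mul1r -cs; ring.
have hy : y = cos t * (sin t * x + cos t * y) - sin t * (cos t * x - sin t * y).
  by rewrite -[LHS]mul1r -cs; ring.
rewrite h1 h2 !mulr0 ?addr0 ?subr0 in hx hy.
by rewrite hx hy.
Qed.

Lemma circle_circle_pt (a : C) (r y : R) : 0 <= r ->
  circle a r (circle_pt a r y).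
Proof.
move=> r0; rewrite /circle /= /circle_pt; case: a => p q /=.
have -> : ((p + r * cos y) +i* (q - r * sin y)) - (p +i* q) =
    (r * cos y) +i* (- (r * sin y)) :> C.
  by apply/eqP; rewrite eq_complex /=; apply/andP; split; apply/eqP; ring.
rewrite normc_def /=; congr (_%:C).
have -> : (r * cos y) ^+ 2 + (- (r * sin y)) ^+ 2 = r ^+ 2.
  by rewrite sqrrN !exprMn -mulrDr cos2Dsin2 mulr1.
by rewrite sqrtr_sqr ger0_norm.
Qed.

(** The coordinate of the tangent of direction [y], multiplied by [v = e^{-iy}], is
    a polynomial in [v]. *)
Lemma line_coord_tangent (a : C) (r y : R) (v := (cos y -i* sin y) : C) :
  a + (2 * r)%:C * v + conjc a * v ^+ 2 =
    (2 * (Re a * cos y - Im a * sin y) + 2 * r)%:C * v.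
Proof.
have cs := cos2Dsin2 y; rewrite /v; case: a => p q.
have hp : p * (cos y ^+ 2 + sin y ^+ 2) = p by rewrite cs mulr1.
have hq : q * (cos y ^+ 2 + sin y ^+ 2) = q by rewrite cs mulr1.
apply/eqP; rewrite eq_complex /=; apply/andP; split; apply/eqP.
  by rewrite -{1}hp; ring.
by rewrite -{1}hq; ring.
Qed.

Lemma cis_conj_half_sum (y : R) (v := (cos y -i* sin y) : C) :
  1 + v ^+ 2 = 2 * (cos y)%:C * v.
Proof.
have cs := cos2Dsin2 y; rewrite /v.
apply/eqP; rewrite eq_complex /=; apply/andP; split; apply/eqP; last by ring.
by rewrite -{1}cs; ring.
Qed.

Section OneCircle.
Variables b c d e f g h : R.
Hypotheses (hbcd : b ^+ 2 + c ^+ 2 + d ^+ 2 = 1)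
  (hefgh : e ^+ 2 + f ^+ 2 + g ^+ 2 + h ^+ 2 = 1)
  (horth : c * e + d * f = 0)
  (hce : e = 0 -> c = 0) (hh0 : h <> 0) (hcd : 0 < c ^+ 2 + d ^+ 2).
Variables (a : C) (r : R).
Hypotheses (r0 : 0 < r)
  (hcircle : circle a r `<=` kippenhahn_curve (mxA b c d e f g h)).

Local Notation pen := (pencil d f g h).
Local Notation penN := (pencilN d f g h).
Local Notation penD := (pencilD d f g h).

Lemma circle_branch y : exists (mu : R -> R) (t : R),
  [/\ forall u, pen (mu u) (cos u) = 0,
    mu t = line_coord (circle_pt a r y) t &
    is_derive t (1 : R) mu (line_coord' (circle_pt a r y) t)].
Proof.
apply: (kippenhahn_curve_branch hbcd hefgh horth).
exact/hcircle/circle_circle_pt/ltW.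
Qed.

Lemma pencilD_neq0 : penD != 0.
Proof.
apply/eqP => D0.
have /(_ 5) /= : forall i, [:: 0; 2 * (h * (1 - d ^+ 2) + d * f * g); 0;
    - (4 * h); 0; 2 * h]`_i = 0.
  apply: (horner_rec_infinite (@infinite_setT_real R)) => m _ /=.
  have := congr1 (fun p => p.[m]) D0.
  by rewrite /pencilD !hornerE /= => e0; rewrite -[RHS]e0; ring.
by move: hh0 => /eqP h0 /eqP; rewrite mulf_eq0 (negbTE h0) pnatr_eq0.
Qed.

Lemma pencil_poly_neq0 (x : R) : penN - x%:P * penD != 0.
Proof.
apply/eqP => ND0; pose k := f ^+ 2 + g ^+ 2.
have /(_ 6) /= : forall i,
    [:: (1 - d ^+ 2) * (h ^+ 2 - 1) + k - d ^+ 2 * g ^+ 2;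
        - (2 * x * (h * (1 - d ^+ 2) + d * f * g));
        3 - d ^+ 2 - 2 * h ^+ 2 - k; 4 * h * x; h ^+ 2 - 3; - (2 * h * x);
        1]`_i = 0.
  apply: (horner_rec_infinite (@infinite_setT_real R)) => m _ /=.
  have := congr1 (fun p => p.[m]) ND0.
  rewrite hornerD hornerN hornerM hornerC -pencilE horner0 => e0.
  by rewrite -[RHS]e0 /pencil /k; ring.
by move/eqP; rewrite oner_eq0.
Qed.

Lemma pencil_opp (m x : R) : pen (- m) (- x) = pen m x.
Proof. by rewrite /pencil; ring. Qed.

Lemma pencilD'E k : penD^`().[k] =
  2 * (h * ((k ^+ 2 - 1) ^+ 2 - d ^+ 2) + d * f * g)
  + 8 * h * k ^+ 2 * (k ^+ 2 - 1).
Proof.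
by rewrite /pencilD -(polyC_natr _ 2) !poly.derivE !hornerE /=; ring.
Qed.

(** Infinitely many tangents of the circle belong to the family. *)
Lemma infinite_tangent_root : infinite_set [set y | 0 <= y <= 1 /\
  pen (2 * (Re a * cos y - Im a * sin y) + 2 * r) (cos y) = 0].
Proof.
have r_neq0 : r != 0 by rewrite gt_eqF.
(* For t = y + pi the same tangent is read with the opposite normal, as
   (- m, - x). *)
have tangentP (P : R -> R -> R) :
    (forall m x, P m x = 0 -> pen m x = 0) ->
    infinite_set [set y | 0 <= y <= 1 /\ exists t, sin (t - y) = 0 /\
      P (line_coord (circle_pt a r y) t) (cos t) = 0] ->
    infinite_set [set y | 0 <= y <= 1 /\
      pen (2 * (Re a * cos y - Im a * sin y) + 2 * r) (cos y) = 0].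
  move=> hP; apply: sub_infinite_set => y /= [y01 [t [st /hP]]].
  rewrite line_coord_circle_pt => Pt; split => //.
  have : cos (t - y) ^+ 2 = 1.
    by rewrite -(cos2Dsin2 (t - y)) st; ring.
  have tE : t = (t - y) + y by rewrite subrK.
  have ct : cos t = cos (t - y) * cos y.
    by rewrite {1}tE cosD st; ring.
  have sit : sin t = cos (t - y) * sin y.
    by rewrite {1}tE sinD st; ring.
  move: Pt; rewrite ct sit; move: (cos (t - y)) => k Pk /eqP.
  rewrite sqrf_eq1 => /orP[] /eqP kE; move: Pk; rewrite kE.
    by rewrite !mul1r => Pk; rewrite -[RHS]Pk; congr pencil; ring.
  by rewrite !mulN1r => Pk; rewrite -[RHS]Pk -[LHS]pencil_opp; congr pencil; ring.
(* The alternative is whether the pencil is divisible by m^2; the two quantities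
   are the coefficient of m^1, up to the factor - 2 x, and that of m^0. *)
have [ndeg|] := boolP ((h * (1 - d ^+ 2) + d * f * g != 0) ||
    ((1 - d ^+ 2) * (h ^+ 2 - 1) + (f ^+ 2 + g ^+ 2) - d ^+ 2 * g ^+ 2 != 0)).
  apply: (tangentP (fun m x => penN.[m] - x * penD.[m])) => [m x|].
    by rewrite -pencilE.
  apply: (infinite_tangent (X := set0)) => //.
  - by move=> x _; exact: pencil_poly_neq0.
  - exact: pencilD_neq0.
  - move=> k; rewrite pencilD'E.
    have -> : penD.[k] =
        2 * k * (h * ((k ^+ 2 - 1) ^+ 2 - d ^+ 2) + d * f * g).
      by rewrite /pencilD !hornerE /=; ring.
    have -> : penN.[k] = pen k 0 by rewrite pencilE; ring.
    have [->|k0 /eqP] := eqVneq k 0 => [_ D'0 P0 _|].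
      move: ndeg; apply/negP; rewrite negb_or !negbK; apply/andP.
      split; apply/eqP; last by rewrite -[RHS]P0 /pencil; ring.
      apply: (mulfI (_ : 2 != 0)); first by rewrite pnatr_eq0.
      by rewrite mulr0 -[RHS]D'0; ring.
    rewrite !mulf_eq0 pnatr_eq0 (negbTE k0) /= => /eqP E0.
    have nz : 8 * h * k ^+ 2 != 0.
      by rewrite mulf_neq0 ?expf_neq0 // mulf_neq0 ?pnatr_eq0 //; apply/eqP.
    rewrite E0 mulr0 add0r => /eqP; rewrite mulf_eq0 (negbTE nz) => /eqP s0.
    rewrite /pencil s0 => P0 _.
    have d0 : d = 0.
      have h2 : 0 < h ^+ 2 by rewrite exprn_even_gt0 //; apply/eqP.
      have g2 := sqr_ge0 g.
      have : d ^+ 2 * (h ^+ 2 + g ^+ 2) = 0 by rewrite -[RHS]oppr0 -P0; ring.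
      move/eqP; rewrite mulf_eq0 sqrf_eq0 => /orP[/eqP //|/eqP]; lra.
    move: horth; rewrite d0 mul0r addr0 => /eqP; rewrite mulf_eq0 => h0.
    have c0 : c = 0 by case/orP: h0 => /eqP // /hce.
    by move: hcd; rewrite c0 d0 !expr0n /= addr0 ltxx.
  - move=> y _ _; have [mu [t [hmu mut dmu]]] := circle_branch y.
    exists t; split; first by rewrite -pencilE -mut; exact: hmu.
    rewrite -mut; apply: (is_derive_dnbhs0 _ (is_derive_pencil _ _ dmu)).2.
    by near=> u; rewrite -pencilE; exact: hmu.
(* Divide by m^2: N2 - x D2 is the quotient. *)
rewrite negb_or !negbK => /andP[/eqP E0 /eqP N0].
pose k := f ^+ 2 + g ^+ 2.
pose N2 : {poly R} :=
  ('X ^+ 2 - 2%:P) * ('X ^+ 2 - 1 + (h ^+ 2)%:P) + (1 - d ^+ 2 - k)%:P.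
pose D2 : {poly R} := (2 * h)%:P * 'X * ('X ^+ 2 - 2%:P).
have D2E m : D2.[m] = 2 * h * m * (m ^+ 2 - 2) by rewrite /D2 !hornerE.
have N2E m : N2.[m] = (m ^+ 2 - 2) * (m ^+ 2 - 1 + h ^+ 2) + (1 - d ^+ 2 - k).
  by rewrite /N2 !hornerE.
have PE m x : pen m x = m * (m * (N2.[m] - x * D2.[m])).
  rewrite D2E N2E; transitivity (m * (m * ((m ^+ 2 - 2) * (m ^+ 2 - 1 + h ^+ 2)
    + (1 - d ^+ 2 - k) - x * (2 * h * m * (m ^+ 2 - 2))))
    + ((1 - d ^+ 2) * (h ^+ 2 - 1) + (f ^+ 2 + g ^+ 2) - d ^+ 2 * g ^+ 2)
    - 2 * m * x * (h * (1 - d ^+ 2) + d * f * g)).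
    by rewrite /pencil /k; ring.
  by rewrite E0 N0; ring.
apply: (tangentP (fun m x => N2.[m] - x * D2.[m])) => [m x P0|].
  by rewrite PE P0 !mulr0.
apply: (infinite_tangent
  (X := [set y | 0 <= y <= 1 /\ circle_pt a r y = 0])) => //.
- move=> x _; apply/eqP => ND0.
  have /(_ 4) /= : forall i, [:: (1 - d ^+ 2 - k) - 2 * (h ^+ 2 - 1); 4 * h * x;
      h ^+ 2 - 3; - (2 * h * x); 1]`_i = 0.
    apply: (horner_rec_infinite (@infinite_setT_real R)) => m _ /=.
    have := congr1 (fun p => p.[m]) ND0.
    rewrite hornerD hornerN hornerM hornerC horner0 D2E N2E => e0.
    by rewrite -[RHS]e0; ring.
  by move/eqP; rewrite oner_eq0.
- apply/eqP => D20; have := D2E 1; rewrite D20 horner0 => h1.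
  by apply: hh0; lra.
- move=> m; rewrite D2E.
  have -> : D2^`().[m] = 2 * h * (3 * m ^+ 2 - 2).
    by rewrite /D2 !poly.derivE !hornerE /=; ring.
  move: hh0 => /eqP h0 /eqP; rewrite !mulf_eq0 pnatr_eq0 (negbTE h0) /=.
  move=> m0 /eqP; rewrite !mulf_eq0 pnatr_eq0 (negbTE h0) /= => /eqP m2.
  by case/orP: m0 => /eqP m0; [move: m2; rewrite m0 expr0n /=|]; lra.
- have : finite_set [set y | 0 <= y <= 1 /\
      2 * (1 * Re (circle_pt a r y) - 0 * Im (circle_pt a r y)) = 0].
    apply: (finite_line_circle a (l := (1, 0, 0)) r_neq0) => /=; ring.
  apply: sub_finite_set => y [y01 z0]; split => //.
  by rewrite z0 /=; ring.
- move=> y y01 z0; have [mu [t [hmu mut dmu]]] := circle_branch y.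
  have dP := is_derive_pencil N2 D2 dmu.
  have PP u : mu u * (mu u * (N2.[mu u] - cos u * D2.[mu u])) = 0.
    by rewrite -PE; exact: hmu.
  have {}PP u : mu u * (N2.[mu u] - cos u * D2.[mu u]) = 0.
    have /eqP := PP u; rewrite mulf_eq0 => /orP[/eqP ->|/eqP //].
    by rewrite mul0r.
  (* Where m vanishes to first order, the point of the curve is the origin. *)
  have [[mu0 dmu0]|P0] := is_derive_mul_dnbhs0 (nearW _ PP) dmu.
    by case: z0; split => //; apply: (@line_coord_eq0 _ t); rewrite -?mut.
  by exists t; rewrite -mut; exact: is_derive_dnbhs0 P0 dP.
Unshelve. all: by end_near. Qed.

(** The centre is an eigenvalue: [a^5 (a - h)] is the leading coefficient, in
    [e^{iy}], of the equation satisfied by the tangents.  In terms of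
    [v = e^{-iy}] it is the value at [v = 0]. *)
Lemma circle_center_eigenvalue : a ^+ 5 * (a - h%:C) = 0.
Proof.
pose cst (x : R) : {poly C} := (x%:C)%:P.
pose M : {poly C} := a%:P + cst (2 * r) * 'X + (conjc a)%:P * 'X ^+ 2.
pose Q := homogenized M (d ^+ 2)%:C (h ^+ 2)%:C (f ^+ 2 + g ^+ 2)%:C
  (d ^+ 2 * g ^+ 2)%:C h%:C (d * f * g)%:C.
have Q0 : Q = 0.
  apply: contrapT => /eqP Qn0; apply: infinite_tangent_root.
  have := finite_image (@complex.Re R) (finite_roots Qn0).
  move/finite_cos_preimage; apply: sub_finite_set => y /= [y01 Py].
  split => //; exists (cos y -i* sin y) => //.
  pose v : C := cos y -i* sin y.
  pose m : C := (2 * (Re a * cos y - Im a * sin y) + 2 * r)%:C.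
  have Mv : M.[v] = m * v by rewrite -line_coord_tangent /M /cst !hornerE.
  rewrite horner_homogenized -/v.
  rewrite Mv cis_conj_half_sum -/v.
  transitivity (v ^+ 6 * (pencil d f g h
    (2 * (Re a * cos y - Im a * sin y) + 2 * r) (cos y))%:C); last first.
    by rewrite Py mulr0.
  rewrite /pencil /m.
  move: (2 * (Re a * cos y - Im a * sin y) + 2 * r) => m0.
  rewrite !(rmorphB, rmorphD, rmorphM, rmorphXn, rmorph1) /=.
  by ring.
have M0 : M.[0] = a by rewrite /M /cst !hornerE /=; ring.
have := congr1 (fun p => p.[0]) Q0.
rewrite horner0 horner_homogenized M0 => Qa.
by rewrite -[RHS]Qa; ring.
Qed.

Lemma circle_center : a = 0.
Proof.
have /eqP := circle_center_eigenvalue.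
rewrite mulf_eq0 expf_eq0 /= subr_eq0 => /orP[/eqP //|/eqP ah].
(* With a = h the tangent has m = 2 h x + 2 r; eliminating x leaves a polynomial
   in m of degree 5 with leading coefficient 2 r. *)
have h0 : h != 0 by apply/eqP.
pose dl := d * f * g / h; pose k := f ^+ 2 + g ^+ 2.
have infI := infinite_tangent_root; rewrite ah /= in infI.
have /(_ 5) /= : forall i,
   [:: (1 - d ^+ 2) * (h ^+ 2 - 1) + k - d ^+ 2 * g ^+ 2;
       2 * r * (1 - d ^+ 2 + dl); - 2 * (h ^+ 2 - 1) - k - dl; - (4 * r);
       h ^+ 2 - 1; 2 * r]`_i = 0.
  pose I : set R := [set m | pencil d f g h m ((m - 2 * r) / (2 * h)) = 0].
  have {}infI : infinite_set I.
    move=> finI; apply: infI.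
    have := finite_image (fun m => (m - 2 * r) / (2 * h)) finI.
    move/finite_cos_preimage; apply: sub_finite_set => y /= [y01 Py].
    have yE : (2 * h * cos y + 2 * r - 2 * r) / (2 * h) = cos y by field.
    split => //; exists (2 * h * cos y + 2 * r) => //=.
    by rewrite /I /= yE -[RHS]Py; congr pencil; ring.
  apply: (horner_rec_infinite infI) => m /= Im.
  rewrite -[RHS]Im /pencil /k /dl; field.
  exact: h0.
by move/eqP; rewrite mulf_eq0 pnatr_eq0 /= gt_eqF.
Qed.

(** The two coefficients of the pencil in [x] vanish at [m = 2 r]. *)
Lemma circle_pencil (S := (2 * r) ^+ 2 - 1) :
  h * (S ^+ 2 - d ^+ 2) + d * f * g = 0 /\
  (S ^+ 2 - d ^+ 2) * (S + h ^+ 2) - S * (f ^+ 2 + g ^+ 2)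
    - d ^+ 2 * g ^+ 2 = 0.
Proof.
have infI := infinite_tangent_root; rewrite circle_center /= in infI.
have {}infI : infinite_set [set x | pencil d f g h (2 * r) x = 0].
  move=> /finite_cos_preimage; apply: sub_infinite_set infI => y /= [y01 Py].
  by split=> //; rewrite -[RHS]Py; congr pencil; ring.
have hs : forall i, [:: (S ^+ 2 - d ^+ 2) * (S + h ^+ 2)
    - S * (f ^+ 2 + g ^+ 2) - d ^+ 2 * g ^+ 2;
    - (4 * r) * (h * (S ^+ 2 - d ^+ 2) + d * f * g)]`_i = 0.
  apply: (horner_rec_infinite infI) => x /= Px.
  by rewrite -[RHS]Px /pencil /S; ring.
split; last exact: (hs 0).
have /eqP := hs 1; rewrite /= mulf_eq0 oppr_eq0 mulf_eq0 pnatr_eq0 /= gt_eqF //=.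
by move/eqP.
Qed.

End OneCircle.
End CircleInCurve.

(** * The split case: two circles and an ellipse *)

Lemma split_factorization (K : comNzRingType) (X p q lp lm d h x : K) :
  4 * p ^+ 2 = 1 - d -> 4 * q ^+ 2 = 1 + d -> lp + lm = h * x ->
  4 * (lp * lm) = h ^+ 2 - 1 ->
  let m := 2 * X in let s := m ^+ 2 - 1 in
  64 * ((p - X) * ((- p - X) * ((q - X) * ((- q - X) *
    ((lp - X) * (lm - X)))))) =
  (s ^+ 2 - d ^+ 2) * (s + h ^+ 2) - 2 * m * x * (h * (s ^+ 2 - d ^+ 2)).
Proof.
move=> hp hq hD hM m s.
transitivity ((m ^+ 2 - 4 * p ^+ 2) * (m ^+ 2 - 4 * q ^+ 2) *
    (4 * (lp * lm) - 2 * m * (lp + lm) + m ^+ 2)); first by rewrite /m; ring.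
by rewrite hp hq hD hM /s; ring.
Qed.

Section SplitCase.
Variable R : realType.
Local Notation C := R[i].
Local Notation Re := complex.Re.
Local Notation Im := complex.Im.

Lemma sqr_line_coord (z : C) (t : R) :
  line_coord z t ^+ 2 + line_coord' z t ^+ 2 = 4 * (Re z ^+ 2 + Im z ^+ 2).
Proof.
have cs := cos2Dsin2 t; rewrite /line_coord /line_coord'.
transitivity (4 * (Re z ^+ 2 + Im z ^+ 2) * (cos t ^+ 2 + sin t ^+ 2)).
  by ring.
by rewrite cs mulr1.
Qed.

Lemma normc_eq (z : C) (r : R) : 0 <= r -> Re z ^+ 2 + Im z ^+ 2 = r ^+ 2 ->
  `|z| = r%:C.
Proof.
by case: z => x y /= r0 xy; rewrite normc_def /= xy sqrtr_sqr ger0_norm.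
Qed.

Lemma sqr_normc (z : C) (r : R) : `|z| = r%:C ->
  0 <= r /\ Re z ^+ 2 + Im z ^+ 2 = r ^+ 2.
Proof.
case: z => x y; rewrite normc_def /= => -[<-].
by rewrite sqrtr_ge0 sqr_sqrtr // addr_ge0 // sqr_ge0.
Qed.

Lemma circle0_tangent (z : C) (r t : R) : 0 <= r ->
  line_coord z t ^+ 2 = 4 * r ^+ 2 -> line_coord' z t = 0 -> circle 0 r z.
Proof.
move=> r0 m2 m'0; rewrite /circle /= subr0; apply: normc_eq => //.
by have := sqr_line_coord z t; rewrite m2 m'0; lra.
Qed.

Lemma circle0_line_coord (z : C) (r : R) : 0 < r -> circle 0 r z ->
  exists t, line_coord z t = 2 * r /\ line_coord' z t = 0.
Proof.
move=> r0; rewrite /circle /= subr0 => /sqr_normc[_ xy].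
have r_neq0 : r != 0 by rewrite gt_eqF.
have [t [_ ct st]] : exists t : R, [/\ -4 <= t < 4, cos t = Re z / r &
    sin t = - Im z / r].
  by apply: ex_angle; rewrite mulNr sqrrN !expr_div_n -mulrDl xy divff ?expf_neq0.
exists t; rewrite /line_coord /line_coord' ct st; split; last by field.
transitivity (2 * ((Re z ^+ 2 + Im z ^+ 2) / r)); first by field.
by rewrite xy; field.
Qed.

Section Branches.
Variables b d e h : R.
Hypotheses (hd0 : 0 < d) (hd1 : d < 1) (hh0 : 0 < h) (hh1 : h <= 1)
  (hbd : b ^+ 2 + d ^+ 2 = 1) (heh : e ^+ 2 + h ^+ 2 = 1).

Local Notation A := (mxA b 0 d e 0 0 h).
Local Notation r1 := (Num.sqrt (1 - d) / 2).
Local Notation r2 := (Num.sqrt (1 + d) / 2).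

Lemma inner_gt0 : 0 < r1.
Proof. by rewrite divr_gt0 // sqrtr_gt0 subr_gt0. Qed.

Lemma outer_gt0 : 0 < r2.
Proof. by rewrite divr_gt0 // sqrtr_gt0 addr_gt0. Qed.

Lemma sqr_inner : 4 * r1 ^+ 2 = 1 - d.
Proof. by rewrite expr_div_n sqr_sqrtr ?subr_ge0 ?ltW //; field. Qed.

Lemma sqr_outer : 4 * r2 ^+ 2 = 1 + d.
Proof. by rewrite expr_div_n sqr_sqrtr ?addr_ge0 ?ltW //; field. Qed.


Lemma pencil_split (m x : R) : pencil d 0 0 h m x =
  (m ^+ 2 - (1 - d)) * ((m ^+ 2 - (1 + d)) *
    (m ^+ 2 - 1 + h ^+ 2 - 2 * h * m * x)).
Proof. by rewrite /pencil; ring. Qed.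

Let hbcd : b ^+ 2 + 0 ^+ 2 + d ^+ 2 = 1.
Proof. by rewrite expr0n addr0. Qed.
Let hefgh : e ^+ 2 + 0 ^+ 2 + 0 ^+ 2 + h ^+ 2 = 1.
Proof. by rewrite expr0n !addr0. Qed.
Let horth : 0 * e + d * 0 = 0 :> R.
Proof. by rewrite mul0r mulr0 addr0. Qed.

(** The six branches: the four constant ones and the two branches [lp] and [lm] of
    the ellipse. *)
Definition split_branches (lp lm : R -> R) : seq (R -> R) :=
  [:: cst r1; cst (- r1); cst r2; cst (- r2); lp; lm].

Lemma eigen_branches_split (lp lm : R -> R) :
  (forall t, lp t + lm t = h * cos t) ->
  (forall t, 4 * (lp t * lm t) = h ^+ 2 - 1) ->
  (forall t, derivable lp t (1 : R)) -> (forall t, derivable lm t (1 : R)) ->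
  eigen_branches A (fun j : 'I_6 => nth (cst 0) (split_branches lp lm) j).
Proof.
move=> hD hM dlp dlm; split=> [t|]; last first.
  have dcst (k : R) t : derivable (cst k) t (1 : R) by exact: derivable_cst.
  move=> [j hj] t /=; move: j hj.
  case=> [_|]; first exact: dcst.
  case=> [_|]; first exact: dcst.
  case=> [_|]; first exact: dcst.
  case=> [_|]; first exact: dcst.
  case=> [_|]; first exact: dlp.
  case=> [_|//]; exact: dlm.
rewrite !big_ord_recl big_ord0 mulr1 /=.
pose k (x : R) : {poly C} := (x%:C)%:P.
have kM x y : k (x * y) = k x * k y by rewrite /k rmorphM polyCM.
have kD x y : k (x + y) = k x + k y by rewrite /k rmorphD polyCD.
have kN x : k (- x) = - k x by rewrite /k rmorphN polyCN.
have k1 : k 1 = 1 by rewrite /k rmorph1.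
have kn n : k n%:R = n%:R by rewrite /k rmorph_nat polyC_natr.
have h64 : 64 != 0 :> {poly C} by rewrite -(polyC_natr _ 64) polyC_eq0 pnatr_eq0.
apply: (mulfI h64); rewrite kippenhahn_poly_mxA //.
move: sqr_inner sqr_outer; move: r1 r2 => p q hp hq.
have e1 := congr1 k hp; have e2 := congr1 k hq.
have e3 := congr1 k (hD t); have e4 := congr1 k (hM t).
rewrite !(expr2, kM, kD, kN, k1, kn) -?expr2 in e1 e2 e3 e4.
rewrite -/(k 0) -/(k d) -/(k h) -/(k (cos t)) -/(k p) -/(k q).
rewrite -/(k (- p)) -/(k (- q)) !kN.
have -> : k 0 = 0 by rewrite /k rmorph0.
rewrite (split_factorization _ e1 e2 e3 e4).
by ring.
Qed.

Lemma split_curve_sub (z : C) : kippenhahn_curve A z ->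
  (circle 0 r1 `|` circle 0 r2 `|` ellipse 0 h%:C 1) z.
Proof.
move=> /(kippenhahn_curve_branch hbcd hefgh horth)[mu [t [hmu mut dmu]]].
set m' := line_coord' z t in dmu.
have dsq k : is_derive t (1 : R) (fun u => mu u ^+ 2 - k) (2 * mu t * m').
  have -> : (fun u => mu u ^+ 2 - k) = mu * mu - cst k.
    by apply/funext => u; rewrite !fctE expr2.
  by apply: is_derive_eq; rewrite !scaleRE; ring.
have sq0 k : 0 < k -> mu t ^+ 2 - k = 0 -> 2 * mu t * m' = 0 ->
    mu t ^+ 2 = k /\ m' = 0.
  move=> k0 /eqP; rewrite subr_eq0 => /eqP mk /eqP.
  rewrite mulf_eq0 mulf_eq0 pnatr_eq0 /= => /orP[/eqP mt0|/eqP //].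
  by move: k0; rewrite -mk mt0 expr0n ltxx.
have d1 : 0 < 1 - d by rewrite subr_gt0.
have d2 : 0 < 1 + d by rewrite addr_gt0.
pose q (u : R) := mu u ^+ 2 - 1 + h ^+ 2 - 2 * h * mu u * cos u.
have split0 u : (mu u ^+ 2 - (1 - d)) * ((mu u ^+ 2 - (1 + d)) * q u) = 0.
  by rewrite -pencil_split.
have [[m1 m'1]|] := is_derive_mul_dnbhs0 (nearW _ split0) (dsq _).
  have [m2 m'0] := sq0 _ d1 m1 m'1; left; left.
  apply: (circle0_tangent (ltW inner_gt0) _ m'0).
  by rewrite -mut m2 sqr_inner.
move=> split1; have [[m1 m'1]|q0] := is_derive_mul_dnbhs0 split1 (dsq _).
  have [m2 m'0] := sq0 _ d2 m1 m'1; left; right.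
  apply: (circle0_tangent (ltW outer_gt0) _ m'0).
  by rewrite -mut m2 sqr_outer.
right; rewrite /ellipse sub0r normrN.
have -> : `|h%:C : C| = h%:C by apply: normc_eq; [exact: ltW|rewrite /=; ring].
have [h1|hn1] := eqVneq h 1.
  rewrite h1 eqxx /=.
  (* For h = 1 the third factor splits as m (m - 2 cos t), one factor for each
     focus. *)
  have split2 : \forall u \near t^', mu u * (mu u - 2 * cos u) = 0.
    near=> u; have : q u = 0 by near: u.
    by rewrite /q h1 => qu; rewrite -[RHS]qu; ring.
  have [[m0 m'0]|] := is_derive_mul_dnbhs0 split2 dmu.
    by left; apply: (@line_coord_eq0 _ _ t); rewrite -?mut.
  move=> split3; right.
  have dl : is_derive t (1 : R) (fun u => mu u - 2 * cos u) (m' + 2 * sin t).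
    have -> : (fun u => mu u - 2 * cos u) = mu - 2 \*: @cos R by [].
    by apply: is_derive_eq; rewrite scaleRE; ring.
  have [m0 m'0] := is_derive_dnbhs0 split3 dl.
  rewrite /= -[X in _ = X]add0r; apply/eqP; rewrite -subr_eq; apply/eqP.
  apply: (@line_coord_eq0 _ _ t).
    by rewrite -[RHS]m0 mut /line_coord; case: (z) => x y /=; ring.
  by rewrite -[RHS]m'0 /m' /line_coord'; case: (z) => x y /=; ring.
have -> : (h%:C == 1%:C :> C) = false.
  by apply/negbTE; rewrite (inj_eq (@complexI R)).
rewrite /= subr0.
have dq : is_derive t (1 : R) q
    (2 * mu t * m' - 2 * h * (m' * cos t - mu t * sin t)).
  have -> : q = (fun u => mu u ^+ 2 - (1 - h ^+ 2)) - (2 * h) \*: (mu * @cos R).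
    by apply/funext => u; rewrite !fctE /= scaleRE /q; ring.
  have dsqh := dsq (1 - h ^+ 2).
  by apply: is_derive_eq; rewrite !scaleRE; ring.
have [q1 q2] := is_derive_dnbhs0 q0 dq.
have cs := cos2Dsin2 t.
pose S := mu t - h * cos t.
have S2 : S ^+ 2 = 1 - h ^+ 2 * sin t ^+ 2.
  have -> : 1 - h ^+ 2 * sin t ^+ 2 = q t + 1 - h ^+ 2 * sin t ^+ 2.
    by rewrite q1 add0r.
  by rewrite /q /S; transitivity (mu t ^+ 2 - 2 * h * mu t * cos t
    + h ^+ 2 * (cos t ^+ 2 + sin t ^+ 2) - h ^+ 2 * sin t ^+ 2);
    [ring|rewrite cs; ring].
have h2 : 0 < 1 - h ^+ 2.
  by rewrite subr_gt0 expr_lt1 ?ltW // lt_neqAle hn1.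
have S0 : S != 0.
  rewrite -sqrf_eq0 S2 gt_eqF //; have := sqr_ge0 (cos t) => c0.
  have -> : 1 - h ^+ 2 * sin t ^+ 2 = 1 - h ^+ 2 + h ^+ 2 * cos t ^+ 2.
    by rewrite sin2cos2; ring.
  by rewrite ltr_pwDl // mulr_ge0 // sqr_ge0.
(* The modulus of w is |line_coord w t| / (2 |S|) both for w = z and for
   w = z - h; these two values of line_coord have product 1 - h^2 > 0 and
   sum 2 S. *)
have focal (w : C) (k : R) : (line_coord w t * (h * sin t)) ^+ 2 = (k * S) ^+ 2 ->
    line_coord' w t = k -> `|w| = (`|line_coord w t| / (2 * `|S|))%:C.
  move=> hk hw; apply: normc_eq; first by rewrite divr_ge0 ?mulr_ge0.
  rewrite expr_div_n exprMn !real_normK ?num_real //.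
  have -> : Re w ^+ 2 + Im w ^+ 2 = (line_coord w t ^+ 2 + k ^+ 2) / 4.
    by rewrite -hw sqr_line_coord; field.
  have : (line_coord w t ^+ 2 + k ^+ 2) * S ^+ 2 = line_coord w t ^+ 2.
    transitivity (line_coord w t ^+ 2 * S ^+ 2 + (k * S) ^+ 2); first by ring.
    by rewrite -hk S2; ring.
  by move=> e0; rewrite -[in RHS]e0; field.
have zh : line_coord (z - h%:C) t = mu t - 2 * h * cos t.
  by rewrite mut /line_coord; case: (z) => x y /=; ring.
have zh' : line_coord' (z - h%:C) t = m' + 2 * h * sin t.
  by rewrite /m' /line_coord'; case: (z) => x y /=; ring.
have m'S : m' * S = - (h * mu t * sin t).
  apply: (mulfI (_ : 2 != 0)); first by rewrite pnatr_eq0.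
  apply/eqP; rewrite -subr_eq0; apply/eqP; rewrite -[RHS]q2 /S; ring.
rewrite (@focal z m') ?(@focal (z - h%:C) (m' + 2 * h * sin t)) //; last 2 first.
- by rewrite zh [in RHS]mulrDl m'S /S; ring.
- by rewrite -mut m'S; ring.
rewrite -rmorphD -mulrDl zh -mut; congr (_%:C).
have mn : 0 < mu t * (mu t - 2 * h * cos t).
  have <- : 1 - h ^+ 2 = mu t * (mu t - 2 * h * cos t); last exact: h2.
  by rewrite -[LHS]add0r -{1}q1 /q; ring.
have -> : `|mu t| + `|mu t - 2 * h * cos t| = 2 * `|S|.
  have SE : 2 * S = mu t + (mu t - 2 * h * cos t) by rewrite /S; ring.
  have -> : 2 * `|S| = `|2 * S| by rewrite normrM gtr0_norm.
  rewrite SE.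
  move: mn; have [m0|m0|<-] := ltgtP 0 (mu t); last by rewrite mul0r ltxx.
    rewrite pmulr_rgt0 // => n0.
    by rewrite !gtr0_norm // addr_gt0.
  rewrite nmulr_rgt0 // => n0.
  by rewrite !ltr0_norm // ?opprD // -oppr_gt0 opprD addr_gt0 // oppr_gt0.
by rewrite divff // mulf_neq0 ?pnatr_eq0 ?normr_eq0.
Unshelve. all: by end_near. Qed.

Lemma split_branches_curve (lp lm : R -> R) (z : C) (j : nat) (t : R) :
  (forall t, lp t + lm t = h * cos t) ->
  (forall t, 4 * (lp t * lm t) = h ^+ 2 - 1) ->
  (forall t, derivable lp t (1 : R)) -> (forall t, derivable lm t (1 : R)) ->
  (j < 6)%N -> let l := nth (cst 0) (split_branches lp lm) j in
  2 * l t = line_coord z t ->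
  is_derive t (1 : R) (fun u => 2 * l u) (line_coord' z t) ->
  kippenhahn_curve A z.
Proof.
move=> hD hM dlp dlm hj l lt dl.
exact: (kippenhahn_curve_of_branch (j := Ordinal hj)
  (eigen_branches_split hD hM dlp dlm) lt dl).
Qed.

Lemma split_curve_sup (z : C) :
  (circle 0 r1 `|` circle 0 r2 `|` ellipse 0 h%:C 1) z -> kippenhahn_curve A z.
Proof.
(* For h = 1 the two branches of the ellipse cross and the square root is not
   differentiable there; they are then cos and 0. *)
pose sq (u : R) := Num.sqrt (1 - h ^+ 2 * sin u ^+ 2).
pose lp (u : R) := if h == 1 then cos u else (h * cos u + sq u) / 2.
pose lm (u : R) := if h == 1 then 0 else (h * cos u - sq u) / 2.
have h2 : h != 1 -> 0 < 1 - h ^+ 2.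
  by move=> hn1; rewrite subr_gt0 expr_lt1 ?ltW // lt_neqAle hn1.
have rad_gt0 u : h != 1 -> 0 < 1 - h ^+ 2 * sin u ^+ 2.
  move=> /h2 h20.
  have -> : 1 - h ^+ 2 * sin u ^+ 2 = 1 - h ^+ 2 + h ^+ 2 * cos u ^+ 2.
    by rewrite sin2cos2; ring.
  by rewrite ltr_pwDl // mulr_ge0 // sqr_ge0.
have dsq u : h != 1 ->
    is_derive u (1 : R) sq (- (h ^+ 2 * sin u * cos u) / sq u).
  move=> hn1.
  have -> : sq = Num.sqrt \o (cst 1 - h ^+ 2 \*: (@sin R * @sin R)).
    by apply/funext => v; rewrite /sq /= !fctE /= scaleRE.
  have rad := rad_gt0 u hn1; rewrite [sin u ^+ 2]expr2 in rad.
  have ds := @is_derive1_sqrt R ((cst 1 - h ^+ 2 \*: (@sin R * @sin R)) u) rad.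
  have s0 : Num.sqrt (1 - h ^+ 2 * (sin u * sin u)) != 0.
    by rewrite gt_eqF // sqrtr_gt0.
  apply: is_derive_eq.
  by rewrite !scaleRE /= !fctE /= scaleRE; field.
pose L (k v : R) := (h * cos v + k * sq v) / 2.
have dl u (k : R) : h != 1 -> is_derive u (1 : R) (L k)
      ((- (h * sin u) - k * (h ^+ 2 * sin u * cos u / sq u)) / 2).
  move=> hn1; have dsu := dsq u hn1.
  have -> : L k = 2^-1 \*: (h \*: @cos R + k \*: sq).
    by apply/funext => v; rewrite /L !fctE /= !scaleRE; field.
  by apply: is_derive_eq; rewrite !scaleRE; ring.
have hD u : lp u + lm u = h * cos u.
  by rewrite /lp /lm; case: eqP => [->|_]; field.
have hM u : 4 * (lp u * lm u) = h ^+ 2 - 1.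
  rewrite /lp /lm; case: eqVneq => [->|hn1]; first by rewrite mulr0 mulr0; ring.
  transitivity (h ^+ 2 * cos u ^+ 2 - sq u ^+ 2); first by field.
  by rewrite /sq sqr_sqrtr ?ltW ?rad_gt0 // cos2sin2; ring.
have lpE : h != 1 -> lp = L 1.
  by move=> hn1; apply/funext => v; rewrite /L /lp (negbTE hn1) mul1r.
have lmE : h != 1 -> lm = L (-1).
  by move=> hn1; apply/funext => v; rewrite /L /lm (negbTE hn1) mulN1r.
have lp1 : h = 1 -> lp = @cos R.
  by move=> h1; apply/funext => v; rewrite /lp h1 eqxx.
have lm1 : h = 1 -> lm = cst 0.
  by move=> h1; apply/funext => v; rewrite /lm h1 eqxx.
have dlp u : derivable lp u (1 : R).
  have [h1|hn1] := eqVneq h 1; first by rewrite (lp1 h1); exact: derivable_cos.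
  by rewrite (lpE hn1); have [dL _] := dl u 1 hn1; exact: dL.
have dlm u : derivable lm u (1 : R).
  have [h1|hn1] := eqVneq h 1; first by rewrite (lm1 h1); exact: derivable_cst.
  by rewrite (lmE hn1); have [dL _] := dl u (-1) hn1; exact: dL.
have branch j t := @split_branches_curve lp lm z j t hD hM dlp dlm.
have circle_in j r : (j < 6)%N -> nth (cst 0) (split_branches lp lm) j = cst r ->
    0 < r -> circle 0 r z -> kippenhahn_curve A z.
  move=> hj lE r0 /(circle0_line_coord r0)[t [l0 l1]].
  apply: (branch j t hj); rewrite lE ?l0 ?l1 //.
  exact: (is_derive_cst (2 * r) t 1).
case=> [[z1|z2]|].
- by apply: (circle_in 0 r1) => //; exact: inner_gt0.
- by apply: (circle_in 2 r2) => //; exact: outer_gt0.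
rewrite /ellipse sub0r normrN.
have -> : `|h%:C : C| = h%:C by apply: normc_eq; [exact: ltW|rewrite /=; ring].
have [h1|hn1] := eqVneq h 1.
  have -> : (h%:C == 1%:C :> C) = true by rewrite h1 eqxx.
  case=> [z0|z1].
    apply: (branch 5 0 isT); rewrite [nth _ _ _]/= (lm1 h1) z0.
      by rewrite /line_coord /=; ring.
    have -> : line_coord' (0 : C) 0 = 0 by rewrite /line_coord' /=; ring.
    exact: (is_derive_cst (2 * 0 : R) (0 : R) 1).
  apply: (branch 4 0 isT); rewrite [nth _ _ _]/= (lp1 h1) z1 h1.
    by rewrite /line_coord /=; ring.
  have -> : (fun u => 2 * cos u) = 2 \*: @cos R by [].
  by apply: is_derive_eq; rewrite !scaleRE /line_coord' /=; ring.
have -> : (h%:C == 1%:C :> C) = false.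
  by apply/negbTE; rewrite (inj_eq (@complexI R)).
rewrite /= subr0 => focal.
pose k2 := 1 - h ^+ 2; have k20 : 0 < k2 := h2 hn1.
have k2_neq0 : k2 != 0 by rewrite gt_eqF.
(* The angle t is that of the outer normal at z; it is proportional to
   (u, - v), with w as the factor. *)
have [u uE] : exists u, u = 2 * Re z - h by eexists.
have [v vE] : exists v, v = - 2 * Im z / k2 by eexists.
have uv1 : u ^+ 2 + k2 * v ^+ 2 = 1.
  pose rz := Num.sqrt (Re z ^+ 2 + Im z ^+ 2).
  pose rh := Num.sqrt ((Re z - h) ^+ 2 + Im z ^+ 2).
  have rz2 : rz ^+ 2 = Re z ^+ 2 + Im z ^+ 2.
    by rewrite sqr_sqrtr // addr_ge0 // sqr_ge0.
  have rh2 : rh ^+ 2 = (Re z - h) ^+ 2 + Im z ^+ 2.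
    by rewrite sqr_sqrtr // addr_ge0 // sqr_ge0.
  have rzE : `|z| = rz%:C by apply: normc_eq => //; exact: sqrtr_ge0.
  have rhE : `|z - h%:C| = rh%:C.
    apply: normc_eq; rewrite ?sqrtr_ge0 // rh2.
    by case: (z) => x y /=; ring.
  move: focal; rewrite rzE rhE -rmorphD => /complexI rzh.
  have rhr : rh = 1 - rz by rewrite -rzh; ring.
  (* The focus-directrix form of the equation of the ellipse. *)
  have dir : 2 * rz = k2 + 2 * h * Re z.
    have e0 : rz ^+ 2 - rh ^+ 2 - 2 * h * Re z + h ^+ 2 = 0.
      by rewrite rz2 rh2; ring.
    by apply/eqP; rewrite -subr_eq0; apply/eqP; rewrite -[RHS]e0 rhr /k2; ring.
  have {}dir : 4 * Im z ^+ 2 = (k2 + 2 * h * Re z) ^+ 2 - 4 * Re z ^+ 2.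
    by rewrite -dir exprMn rz2; ring.
  apply: (mulfI k2_neq0); rewrite uE vE.
  transitivity (k2 * (2 * Re z - h) ^+ 2 + 4 * Im z ^+ 2); first by field.
  by rewrite dir /k2; ring.
pose w := Num.sqrt (u ^+ 2 + v ^+ 2).
have uv : u ^+ 2 + v ^+ 2 = 1 + h ^+ 2 * v ^+ 2 by rewrite -uv1 /k2; ring.
have uv0 : 0 < u ^+ 2 + v ^+ 2.
  by rewrite uv ltr_pwDl // mulr_ge0 // sqr_ge0.
have w2 : w ^+ 2 = u ^+ 2 + v ^+ 2 by rewrite sqr_sqrtr // ltW.
have w0 : 0 < w by rewrite sqrtr_gt0.
have w_neq0 : w != 0 by rewrite gt_eqF.
have [t [_ ct st]] : exists t : R,
    [/\ -4 <= t < 4, cos t = u / w & sin t = v / w].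
  by apply: ex_angle; rewrite !expr_div_n -mulrDl -w2 divff // expf_neq0.
have sqw : sq t = w^-1.
  rewrite /sq st expr_div_n.
  have -> : 1 - h ^+ 2 * (v ^+ 2 / w ^+ 2) = w^-1 ^+ 2.
    transitivity ((w ^+ 2 - h ^+ 2 * v ^+ 2) / w ^+ 2); first by field.
    by rewrite {1}w2 uv; field.
  by rewrite sqrtr_sqr gtr0_norm // invr_gt0.
have zX : Re z = (u + h) / 2 by rewrite uE; field.
have zY : Im z = - (k2 * v) / 2 by rewrite vE; field.
apply: (branch 4 t isT); rewrite [nth _ _ _]/= (lpE hn1).
  rewrite /L mul1r sqw /line_coord ct st zX zY.
  transitivity ((h * u + 1) / w); first by field.
  by rewrite -[X in h * u + X]uv1; field.
have dL := dl t 1 hn1.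
have -> : (fun x => 2 * L 1 x) = 2 \*: L 1 by [].
apply: is_derive_eq.
rewrite scaleRE sqw /line_coord' ct st zX zY invrK.
by rewrite /k2; field.
Qed.

End Branches.
End SplitCase.

(** * Conclusion *)

(** If the two coefficients of the pencil in [x] vanish for two values of [s], then
    eliminating [s^2 - d^2] from the second gives an affine function of [s] with
    two zeros. *)
Lemma two_radii_split (R : realType) (d f g h S1 S2 : R) :
  h != 0 -> S1 != S2 ->
  (forall S, S = S1 \/ S = S2 ->
    h * (S ^+ 2 - d ^+ 2) + d * f * g = 0 /\
    (S ^+ 2 - d ^+ 2) * (S + h ^+ 2) - S * (f ^+ 2 + g ^+ 2)
      - d ^+ 2 * g ^+ 2 = 0) ->
  [/\ f = 0, g = 0, S1 = - S2 & S1 ^+ 2 = d ^+ 2].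
Proof.
move=> h0 S12 hS.
have [E1 N1] := hS S1 (or_introl erefl); have [E2 N2] := hS S2 (or_intror erefl).
have SS : S1 = - S2.
  have : h * ((S1 - S2) * (S1 + S2)) = 0.
    by rewrite -[RHS](subrr 0) -{1}E1 -E2; ring.
  move/eqP; rewrite !mulf_eq0 (negbTE h0) subr_eq0 (negbTE S12) /=.
  by rewrite addr_eq0 => /eqP.
pose k := f ^+ 2 + g ^+ 2.
have lin S : h * (S ^+ 2 - d ^+ 2) + d * f * g = 0 ->
    (S ^+ 2 - d ^+ 2) * (S + h ^+ 2) - S * k - d ^+ 2 * g ^+ 2 = 0 ->
    (d * f * g + h * k) * S + h * (d * g * (f * h + d * g)) = 0.
  move=> ES NS.
  transitivity (- (h * ((S ^+ 2 - d ^+ 2) * (S + h ^+ 2) - S * k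
    - d ^+ 2 * g ^+ 2)) + (h * (S ^+ 2 - d ^+ 2) + d * f * g) * (S + h ^+ 2)).
    by ring.
  by rewrite ES NS; ring.
have l1 := lin _ E1 N1; have l2 := lin _ E2 N2.
have c1 : d * f * g + h * k = 0.
  have : (d * f * g + h * k) * (S1 - S2) = 0.
    by rewrite -[RHS](subrr 0) -{1}l1 -l2; ring.
  by move/eqP; rewrite mulf_eq0 (subr_eq0 S1) (negbTE S12) orbF => /eqP.
have c0 : d * g * (f * h + d * g) = 0.
  by move: l1; rewrite c1 mul0r add0r => /eqP; rewrite mulf_eq0 (negbTE h0) => /eqP.
have k0 : k = 0.
  move/eqP: c0; rewrite mulf_eq0 => /orP[/eqP dg|/eqP fh].
    move: c1; have -> : d * f * g = f * (d * g) by ring.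
    by rewrite dg mulr0 add0r => /eqP; rewrite mulf_eq0 (negbTE h0) => /eqP.
  have : h * g ^+ 2 = 0.
    transitivity (d * f * g + h * k - f * (f * h + d * g)); first by rewrite /k; ring.
    by rewrite c1 fh; ring.
  move/eqP; rewrite mulf_eq0 (negbTE h0) sqrf_eq0 /= => /eqP g0.
  move/eqP: fh; rewrite g0 mulr0 addr0 mulf_eq0 (negbTE h0) orbF => /eqP f0.
  by rewrite /k f0 g0; ring.
move/eqP: k0; rewrite /k paddr_eq0 ?sqr_ge0 // !sqrf_eq0.
move=> /andP[/eqP f0 /eqP g0]; split => //.
move: E1; rewrite f0 mulr0 mul0r addr0 => /eqP.
by rewrite mulf_eq0 (negbTE h0) subr_eq0 => /eqP.
Qed.

Theorem theorem8p4 (R : realType) (b c d e f g h : R)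
  (hb : 0 <= b) (hc : 0 <= c) (hd : 0 <= d) (he : 0 <= e) (hh : 0 <= h)
  (hf0 : c * e = 0 -> 0 <= f) (hf1 : c * e <> 0 -> f <= 0)
  (hbcd : b ^+ 2 + c ^+ 2 + d ^+ 2 = 1)
  (hefgh : e ^+ 2 + f ^+ 2 + g ^+ 2 + h ^+ 2 = 1)
  (horth : c * e + d * f = 0)
  (hce : e = 0 -> c = 0)
  (hh0 : h <> 0)
  (hcd : 0 < c ^+ 2 + d ^+ 2) :
  ((exists (a1 a2 : R[i]) (r1 r2 : R),
      (0 < r1 /\ 0 < r2) /\
      circle a1 r1 <> circle a2 r2 /\
      (circle a1 r1 <> circle 0 (1 / 2) /\ circle a2 r2 <> circle 0 (1 / 2)) /\
      (circle a1 r1 `<=` kippenhahn_curve (mxA b c d e f g h) /\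
       circle a2 r2 `<=` kippenhahn_curve (mxA b c d e f g h)))
   <-> (c = 0 /\ f = 0 /\ g = 0) /\ (d <> 0 /\ d <> 1))
  /\
  ((c = 0 /\ f = 0 /\ g = 0) /\ (d <> 0 /\ d <> 1) ->
   kippenhahn_curve (mxA b c d e f g h) =
     circle 0 (Num.sqrt (1 - d) / 2) `|` circle 0 (Num.sqrt (1 + d) / 2)
       `|` ellipse 0 h%:C 1).
Proof.
have h0 : h != 0 by apply/eqP.
have split_curve : (c = 0 /\ f = 0 /\ g = 0) /\ (d <> 0 /\ d <> 1) ->
    [/\ 0 < d, d < 1 & kippenhahn_curve (mxA b c d e f g h) =
     circle 0 (Num.sqrt (1 - d) / 2) `|` circle 0 (Num.sqrt (1 + d) / 2)
       `|` ellipse 0 h%:C 1].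
  move=> [[c0 [f0 g0]] [/eqP d0 /eqP d1]].
  have d_gt0 : 0 < d by rewrite lt_def d0.
  have hbd : b ^+ 2 + d ^+ 2 = 1 by rewrite -hbcd c0; ring.
  have heh : e ^+ 2 + h ^+ 2 = 1 by rewrite -hefgh f0 g0; ring.
  have le1 (x y : R) : 0 <= y -> x ^+ 2 + y ^+ 2 = 1 -> y <= 1.
    move=> y0 xy; rewrite -(@expr_le1 _ 2) // -xy lerDr sqr_ge0 //.
  have d_lt1 : d < 1 by rewrite lt_neqAle d1 (le1 b).
  have h_gt0 : 0 < h by rewrite lt_def h0.
  have h_le1 : h <= 1 by exact: (le1 e).
  split => //; rewrite c0 f0 g0; apply/seteqP; split => z.
    exact: split_curve_sub.
  exact: split_curve_sup.
split; last by case/split_curve.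
split=> [[a1 [a2 [r1 [r2 [[r1_gt0 r2_gt0] [a12 [_ [sub1 sub2]]]]]]]]|].
  have cen := circle_center hbcd hefgh horth hce hh0 hcd.
  have pen := circle_pencil hbcd hefgh horth hce hh0 hcd.
  have r12 : (2 * r1) ^+ 2 - 1 != (2 * r2) ^+ 2 - 1.
    apply/eqP => /addIr /eqP; rewrite eqf_sqr => /orP[] /eqP r12; last first.
      by have := r1_gt0; have := r2_gt0; lra.
    apply: a12; rewrite (cen _ _ r1_gt0 sub1) (cen _ _ r2_gt0 sub2).
    by congr circle; lra.
  have [S|f0 g0 SS Sd] := @two_radii_split _ d f g h _ _ h0 r12.
    by case=> ->; [exact: (pen _ _ r1_gt0 sub1)|exact: (pen _ _ r2_gt0 sub2)].
  have c0 : c = 0.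
    move/eqP: horth; rewrite f0 mulr0 addr0 mulf_eq0 => /orP[/eqP //|/eqP].
    exact: hce.
  split => //; split => [d0|d1].
    by move: hcd; rewrite c0 d0 expr0n /= addr0 ltxx.
  have q1 : 0 < (2 * r1) ^+ 2 by rewrite exprn_gt0 // mulr_gt0.
  have q2 : 0 < (2 * r2) ^+ 2 by rewrite exprn_gt0 // mulr_gt0.
  move: SS Sd; rewrite d1 expr1n.
  move: ((2 * r1) ^+ 2) ((2 * r2) ^+ 2) q1 q2 => x y x0 y0 SS Sd.
  have : x * (x - 2) = 0.
    by transitivity ((x - 1) ^+ 2 - 1); [ring|rewrite Sd subrr].
  by move/eqP; rewrite mulf_eq0 => /orP[]/eqP; lra.
move=> hyp; have [d0 d1 ->] := split_curve hyp.
have s1 : 0 < Num.sqrt (1 - d) / 2 by rewrite divr_gt0 // sqrtr_gt0 subr_gt0.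
have s2 : 0 < Num.sqrt (1 + d) / 2 by rewrite divr_gt0 // sqrtr_gt0 addr_gt0.
have circle_inj (r r' : R) : 0 < r -> circle 0 r = circle 0 r' -> r = r'.
  move=> r_gt0 rr'; have : circle 0 r' (r%:C).
    by rewrite -rr' /circle /= subr0 ger0_norm ?ltcR ?lecR // ltW.
  rewrite /circle /= subr0 ger0_norm ?lecR ?ltW // => /complexI //.
have sqr1 : (Num.sqrt (1 - d) / 2) ^+ 2 = (1 - d) / 4.
  by rewrite expr_div_n sqr_sqrtr ?subr_ge0 ?ltW //; field.
have sqr2 : (Num.sqrt (1 + d) / 2) ^+ 2 = (1 + d) / 4.
  by rewrite expr_div_n sqr_sqrtr ?addr_ge0 ?ltW //; field.
exists 0, 0, (Num.sqrt (1 - d) / 2), (Num.sqrt (1 + d) / 2).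
split; first by [].
split.
  move=> /(circle_inj _ _ s1) /(congr1 (fun x => x ^+ 2)).
  by rewrite sqr1 sqr2; lra.
split; first split.
- move=> /(circle_inj _ _ s1) /(congr1 (fun x => x ^+ 2)).
  by rewrite sqr1 expr_div_n; lra.
- move=> /(circle_inj _ _ s2) /(congr1 (fun x => x ^+ 2)).
  by rewrite sqr2 expr_div_n; lra.
by split => z hz; left; [left|right].
Qed.
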